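(* Let $G$ be a countable, discrete group and let $\omega\in G^*=\beta G\setminus G$ be a rare ultrafilter. Then $\omega$ is wandering in the corona $G^*$, and, hence, $\mathcal{A}_\omega=\mathcal{D}\times_r G$.
   Context: Points of the Stone-Cech compactification $\beta G$ are identified with ultrafilters on $G$; $G^*=\beta G\setminus G$ is the corona. Left multiplication $g_1\mapsto gg_1$ extends to a homeomorphism of $\beta G$, written $\omega\mapsto g\cdot\omega$; this gives an action of $G$ on $\beta G$ which restricts to an action on $G^*$. An ultrafilter on a countable set $N$ is rare if for each partition $N=\bigcup_iP_i$ into finite subsets there exists a set $B$ in the ultrafilter such that for every $i$, $B\cap P_i$ has cardinality at most $1$. A point $\omega$ in a dynamical system (a group $G$ acting on a topological space) is wandering if there exists a neighborhood $U$ of $\omega$ such that $g\cdot U\cap h\cdot U$ is empty for all $g\neq h$ in the group; ''wandering in the corona $G^*$'' refers to the action of $G$ on $G^*$. $\{e_g\}_{g\in G}$ is the canonical orthonormal basis of $\ell^2(G)$, and $U_g=\lambda(g)$ is the left regular representation, $U_ge_h=e_{gh}$. $\mathcal{D}=\{M_f:f\in\ell^\infty(G)\}\subseteq B(\ell^2(G))$ is the algebra of diagonal (multiplication) operators, identified with $\ell^\infty(G)\equiv C(\beta G)$, the continuous extension of $f$ being again denoted $f$. $\pi_\omega:\mathcal{D}\to\mathcal{D}$ is the $*$-homomorphism $\pi_\omega(M_f)=M_h$ with $h(g)=f(g\cdot\omega)$. $\mathcal{D}\times_r G$ is the C*-subalgebra of $B(\ell^2(G))$ generated by $\mathcal{D}$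 and $\{U_g:g\in G\}$; $\pi_\omega\times\lambda:\mathcal{D}\times_r G\to B(\ell^2(G))$ is the $*$-homomorphism with $\pi_\omega\times\lambda(\sum_nM_{f_n}U_{g_n})=\sum_n\pi_\omega(M_{f_n})U_{g_n}$ for finite (or norm convergent) sums; and $\mathcal{A}_\omega=\pi_\omega\times\lambda(\mathcal{D}\times_r G)$. *)

(* Defs.v *)
From HB Require Import structures.
From mathcomp Require Import all_boot all_order all_algebra.
From mathcomp Require Import complex ring.
From mathcomp Require Import all_classical all_reals all_analysis.

Set Implicit Arguments.
Unset Strict Implicit.
Unset Printing Implicit Defensive.
Import Order.TTheory GRing.Theory Num.Theory numFieldNormedType.Exports.
Import Normc.
Local Open Scope classical_set_scope.
Local Open Scope ring_scope.

Record beta (T : Type) := Beta {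
  beta_filter : set_system T;
  beta_ultra : UltraFilter beta_filter }.
#[export] Existing Instance beta_ultra.

HB.instance Definition _ (T : Type) := gen_eqMixin (beta T).
HB.instance Definition _ (T : Type) := gen_choiceMixin (beta T).

Lemma beta_ext (T : Type) (u v : beta T) :
  beta_filter u = beta_filter v -> u = v.
Proof.
by case: u v => [F UF] [F' UF'] /= FF'; subst F'; rewrite (Prop_irrelevance UF UF').
Qed.

Section beta_topology.
Variable T : Type.

Let basic (A : set T) : set (beta T) := [set u | beta_filter u A].

Let basic_cover : \bigcup_(A in setT) basic A = setT.
Proof. by apply/seteqP; split=> // u _; exists setT => //; exact: filterT. Qed.

Let basic_join (A B : set T) (u : beta T) : setT A -> setT B ->
  basic A u -> basic B u ->
  exists C, [/\ setT C, basic C u & basic C `<=` basic A `&` basic B].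
Proof.
move=> _ _ uA uB; exists (A `&` B); split=> //; first exact: filterI.
move=> v; rewrite /basic /= => vAB.
by split; apply: filterS vAB => x [].
Qed.

HB.instance Definition _ :=
  isBaseTopological.Build (beta T) basic_cover basic_join.

End beta_topology.

Lemma nbhs_betaP (T : Type) (u : beta T) (U : set (beta T)) :
  nbhs u U <-> exists2 A, beta_filter u A & [set v | beta_filter v A] `<=` U.
Proof.
split.
  rewrite nbhsE => -[V [[D _ <-] [A DA uA] VU]]; exists A => // v vA.
  by apply: VU; exists A.
move=> [A uA AU]; rewrite nbhsE; exists [set v | beta_filter v A] => //.
split=> //; exists [set A] => //.
by rewrite bigcup_set1.
Qed.

Definition principal (T : Type) (x : T) : beta T :=
  Beta (principal_filter_ultra x).

Lemma fmap_ultra (T U : Type) (f : T -> U) (F : set_system T) :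
  UltraFilter F -> UltraFilter (f @ F).
Proof.
move=> UF; split=> [|H PH sH]; first exact: fmap_proper_filter.
apply/seteqP; split=> // A HA.
have [//|FnA] := in_ultra_setVsetC (f @^-1` A) UF.
have /(filterI HA) : H (~` A) by exact: sH.
by rewrite setICr => /filter_not_empty.
Qed.

(* The continuous extension beta T -> beta U of a map T -> U. *)
Definition beta_map (T U : Type) (f : T -> U) (u : beta T) : beta U :=
  Beta (fmap_ultra f (beta_ultra u)).

Lemma beta_map_principal (T U : Type) (f : T -> U) (x : T) :
  beta_map f (principal x) = principal (f x).
Proof.
by apply: beta_ext; apply/seteqP; split=> A;
  move=> /principal_filterP ?; apply/principal_filterP.
Qed.

Lemma beta_map_continuous (T U : Type) (f : T -> U) :
  continuous (beta_map f).
Proof.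
move=> u V /nbhs_betaP[A uA AV]; apply/nbhs_betaP.
by exists (f @^-1` A) => // v vA; exact: AV.
Qed.

Lemma beta_map_comp (T U V : Type) (f : U -> V) (g : T -> U) (u : beta T) :
  beta_map (f \o g) u = beta_map f (beta_map g u).
Proof. exact: beta_ext. Qed.

Lemma beta_map_id (T : Type) (u : beta T) : beta_map id u = u.
Proof. exact: beta_ext. Qed.

(* As a type, [corona T] carries the subspace topology. *)
Definition corona (T : Type) : set (beta T) := ~` range (@principal T).
Arguments corona : clear implicits.

Section action.
Variable G : groupType.

Definition beta_act (g : G) : beta G -> beta G := beta_map (fun h => (g * h)%g).

Lemma beta_act1 (w : beta G) : beta_act 1%g w = w.
Proof.
rewrite -[RHS]beta_map_id; congr (beta_map _ w).
by apply/funext => h; rewrite mul1g.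
Qed.

Lemma beta_actM (g h : G) (w : beta G) :
  beta_act (g * h)%g w = beta_act g (beta_act h w).
Proof.
rewrite /beta_act -beta_map_comp; congr (beta_map _ w).
by apply/funext => k /=; rewrite mulgA.
Qed.

Lemma corona_act_subproof (g : G) (w : corona G) :
  beta_act g (val w) \in corona G.
Proof.
apply/mem_set => -[h _ gw]; case: (set_valP w); exists (g^-1 * h)%g => //.
have -> : principal (g^-1 * h)%g = beta_act g^-1%g (principal h).
  by rewrite /beta_act beta_map_principal.
by rewrite gw -beta_actM mulVg beta_act1.
Qed.

Definition corona_act (g : G) (w : corona G) : corona G :=
  exist _ (beta_act g (val w)) (corona_act_subproof g w).

Definition wandering (X : topologicalType) (act : G -> X -> X) (x : X) :=
  exists2 U : set X, nbhs x U &
    forall g h : G, g != h -> act g @` U `&` act h @` U = set0.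

End action.

Definition rare (N : Type) (u : beta N) :=
  forall (I : Type) (P : I -> set N),
    partition [set: I] P [set: N] -> (forall i, finite_set (P i)) ->
    exists2 B, beta_filter u B & forall i, is_subset1 (B `&` P i).

Section ell2.
Variables (R : realType) (G : groupType).
Local Notation C := R[i].

Definition sqsum (x : G -> C) : \bar R :=
  \esum_(g in [set: G]) (normc (x g) ^+ 2)%:E.

Definition sqsummable : {pred G -> C} := fun x => (sqsum x < +oo)%E.

Lemma sqsum_ge0 x : (0 <= sqsum x)%E.
Proof. by apply: esum_ge0 => g _; rewrite lee_fin sqr_ge0. Qed.

Lemma normc_ge0 (z : C) : 0 <= normc z.
Proof. by case: z => a b; rewrite sqrtr_ge0. Qed.

Lemma sqsum_le (M : R) (x y : G -> C) :
  (forall g, normc (y g) <= M * normc (x g)) ->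
  (sqsum y <= (M ^+ 2)%:E * sqsum x)%E.
Proof.
move=> yx; apply: ge_ereal_sup => _ [X [finX _] <-].
apply: (@le_trans _ _ (\sum_(g \in X) (M ^+ 2)%:E * (normc (x g) ^+ 2)%:E)%E).
  apply: lee_fsum => // g _; rewrite -EFinM lee_fin -exprMn.
  by rewrite ler_pXn2r ?nnegrE ?normc_ge0// (le_trans (normc_ge0 _) (yx g)).
rewrite -ge0_mule_fsumr; last by move=> g; rewrite lee_fin sqr_ge0.
rewrite lee_wpmul2l// ?lee_fin ?sqr_ge0//.
by apply: ereal_sup_ubound; exists X.
Qed.

Lemma sqsumD_le (x y : G -> C) :
  (sqsum (x + y)%R <= (sqsum x + sqsum x) + (sqsum y + sqsum y))%E.
Proof.
have ge0 (z : G -> C) g : (0 <= (normc (z g) ^+ 2)%:E)%E.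
  by rewrite lee_fin sqr_ge0.
rewrite /sqsum -!esumD => [|g _|g _|g _|g _|g _|g _]; rewrite ?adde_ge0 ?ge0//.
apply: le_esum => g _; rewrite -!EFinD lee_fin.
apply: (@le_trans _ _ ((normc (x g) + normc (y g)) ^+ 2)).
  by rewrite ler_pXn2r ?nnegrE ?addr_ge0 ?normc_ge0//; exact: le_normcD.
rewrite -subr_ge0 (_ : _ - _ = (normc (x g) - normc (y g)) ^+ 2) ?sqr_ge0//.
by ring.
Qed.

Lemma sqsummable_le (M : R) (x y : G -> C) :
  (forall g, normc (y g) <= M * normc (x g)) ->
  x \in sqsummable -> y \in sqsummable.
Proof.
rewrite /sqsummable !unfold_in => /sqsum_le yx xoo; apply: le_lt_trans yx _.
have : sqsum x \is a fin_num by rewrite ge0_fin_numE// sqsum_ge0.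
by move=> /fineK <-; rewrite -EFinM ltry.
Qed.

Lemma sqsummable_submod : submod_closed sqsummable.
Proof.
split=> [|a x y xoo yoo].
  rewrite /sqsummable unfold_in /sqsum esum1// => g _.
  by rewrite normc0 expr0n.
have : a *: x \in sqsummable.
  by apply: (@sqsummable_le (normc a)) xoo => g; rewrite scalrfctE -normcM.
move: yoo; rewrite /sqsummable !unfold_in => yoo axoo.
by apply: le_lt_trans (sqsumD_le _ _) _; rewrite !lte_add_pinfty.
Qed.

HB.instance Definition _ :=
  GRing.isSubmodClosed.Build C (G -> C) sqsummable sqsummable_submod.

Record ell2 := Ell2 { ell2_fun :> G -> C; _ : ell2_fun \in sqsummable }.

HB.instance Definition _ := [isSub for ell2_fun].
HB.instance Definition _ := [Choice of ell2 by <:].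
HB.instance Definition _ := [SubChoice_isSubLmodule of ell2 by <:].

Definition ell2_norm (x : ell2) : R := Num.sqrt (fine (sqsum x)).

Lemma ell2_norm_ge0 (x : ell2) : 0 <= ell2_norm x.
Proof. exact: sqrtr_ge0. Qed.

Lemma ell2_normE (x : ell2) : (ell2_norm x ^+ 2)%:E = sqsum x.
Proof.
rewrite sqr_sqrtr ?fine_ge0 ?sqsum_ge0// fineK// ge0_fin_numE ?sqsum_ge0//.
by case: x.
Qed.

Lemma ell2_norm_le (M : R) (x y : ell2) : 0 <= M ->
  (forall g, normc (y g) <= M * normc (x g)) ->
  ell2_norm y <= M * ell2_norm x.
Proof.
move=> M0 /sqsum_le; rewrite -!ell2_normE -EFinM lee_fin -exprMn.
by rewrite ler_pXn2r ?nnegrE ?mulr_ge0 ?ell2_norm_ge0.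
Qed.

Lemma ell2_normD_le (x y : ell2) :
  ell2_norm (x + y) ^+ 2 <= (ell2_norm x ^+ 2 + ell2_norm y ^+ 2) *+ 2.
Proof.
rewrite -lee_fin ell2_normE; apply: le_trans (sqsumD_le _ _) _.
by rewrite -!ell2_normE -!EFinD lee_fin mulrnDl !mulr2n.
Qed.

(* Sum of an absolutely summable family; [EFin \o u]^\+ and [EFin \o u]^\- are
   the positive and negative parts of u, with values in \bar R. *)
Definition rsum (u : G -> R) : R :=
  fine (\esum_(g in [set: G]) (EFin \o u)^\+ g -
        \esum_(g in [set: G]) (EFin \o u)^\- g)%E.

Definition csum (z : G -> C) : C :=
  (rsum (fun g => complex.Re (z g)) +i* rsum (fun g => complex.Im (z g)))%C.

Definition ell2_dot (x y : ell2) : C := csum (fun g => x g * (y g)^*%C).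

Lemma delta_subproof (g : G) :
  (fun h => (h == g)%:R : C) \in sqsummable.
Proof.
rewrite /sqsummable unfold_in /sqsum.
rewrite (_ : (fun h : G => _) =
    (fun h => if h \in [set g] then 1%E else 0%E)); last first.
  apply/funext => h; have [->|hg] := eqVneq h g.
    by rewrite mem_set// normc1 expr1n.
  by rewrite memNset ?normc0 ?expr0n//; exact/eqP.
by rewrite -esum_mkcond esum_set1// ltry.
Qed.

Definition delta (g : G) : ell2 := Ell2 (delta_subproof g).

Definition operator := ell2 -> ell2.

Definition bounded_op (T : operator) :=
  linear T /\ exists M : R, forall x, ell2_norm (T x) <= M * ell2_norm x.

(* Meaningful for bounded operators only: [sup] is 0 on unbounded sets. *)
Definition op_norm (T : operator) : R :=
  sup [set ell2_norm (T x) | x in [set x | ell2_norm x <= 1]].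

Definition is_adjoint (T S : operator) :=
  forall x y, ell2_dot (T x) y = ell2_dot x (S y).

Record cstar_subalgebra (A : set operator) : Prop := {
  cstar_bounded : A `<=` bounded_op;
  cstar0 : A 0;
  cstarD : forall T S, A T -> A S -> A (T + S);
  cstarZ : forall (a : C) T, A T -> A (a *: T);
  cstarM : forall T S, A T -> A S -> A (T \o S);
  cstar_adj : forall T S, A T -> bounded_op S -> is_adjoint T S -> A S;
  cstar_closed : forall T, bounded_op T ->
    (forall e : R, 0 < e -> exists2 S, A S & op_norm (T - S) < e) -> A T }.

Lemma bounded_op_bound (T : operator) : bounded_op T ->
  exists2 M : R, 0 <= M & forall x, ell2_norm (T x) <= M * ell2_norm x.
Proof.
move=> [_ [M TM]]; exists `|M|; first exact: normr_ge0.
by move=> x; apply: le_trans (TM x) _; rewrite ler_wpM2r ?ell2_norm_ge0// ler_norm.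
Qed.

Lemma bounded_op_cstar : cstar_subalgebra bounded_op.
Proof.
split=> [//| |T S TB SB|a T TB|T S TB SB| |] //.
- split; first by move=> a x y /=; rewrite scaler0 addr0.
  exists 0 => x; apply: ell2_norm_le => // g.
  by rewrite -[X in normc X]/(0 : C) normc0 mul0r.
- have [M M0 TM] := bounded_op_bound TB; have [N N0 SN] := bounded_op_bound SB.
  split.
    by move=> a x y; rewrite !addrfctE TB.1 SB.1 scalerDr addrACA.
  exists (Num.sqrt ((M ^+ 2 + N ^+ 2) *+ 2)) => x.
  have MN0 : 0 <= (M ^+ 2 + N ^+ 2) *+ 2 by rewrite mulrn_wge0 ?addr_ge0 ?sqr_ge0.
  rewrite -(@ler_pXn2r _ 2%N) ?nnegrE ?mulr_ge0 ?ell2_norm_ge0 ?sqrtr_ge0//.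
  apply: le_trans (ell2_normD_le _ _) _.
  rewrite exprMn (sqr_sqrtr MN0) mulrnAl lerMn2r /= mulrDl -!exprMn.
  by rewrite lerD// ler_pXn2r ?nnegrE ?mulr_ge0 ?ell2_norm_ge0.
- have [M M0 TM] := bounded_op_bound TB; split.
    by move=> b x y; rewrite !scalrfctE TB.1 scalerDr !scalerA mulrC.
  exists (normc a * M) => x; rewrite -mulrA.
  apply: (@le_trans _ _ (normc a * ell2_norm (T x))).
    by apply: ell2_norm_le => [|g]; rewrite ?normc_ge0// normcM.
  by rewrite ler_wpM2l ?normc_ge0.
- have [M M0 TM] := bounded_op_bound TB; have [N N0 SN] := bounded_op_bound SB.
  split; first by move=> a x y; rewrite /= SB.1 TB.1.
  exists (M * N) => x; rewrite -mulrA; apply: le_trans (TM _) _.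
  by rewrite ler_wpM2l.
Qed.

Record is_star_hom (A : set operator) (Phi : operator -> operator) : Prop := {
  star_hom_bounded : forall T, A T -> bounded_op (Phi T);
  star_homD : forall T S, A T -> A S -> Phi (T + S) = Phi T + Phi S;
  star_homZ : forall (a : C) T, A T -> Phi (a *: T) = a *: Phi T;
  star_homM : forall T S, A T -> A S -> Phi (T \o S) = Phi T \o Phi S;
  star_hom_adj : forall T S, A T -> A S ->
    is_adjoint T S -> is_adjoint (Phi T) (Phi S) }.

Record linf := Linf {
  linf_fun :> G -> C;
  linfP : exists M : R, forall g, normc (linf_fun g) <= M }.

Lemma mul_op_subproof (f : linf) (x : ell2) :
  (fun g => f g * x g) \in sqsummable.
Proof.
have [M fM] := linfP f; apply: (@sqsummable_le M x); last by case: x.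
by move=> g; rewrite normcM ler_wpM2r ?normc_ge0.
Qed.

Definition mul_op (f : linf) : operator := fun x => Ell2 (mul_op_subproof f x).

Lemma lreg_sqsum (g : G) (x : G -> C) :
  sqsum (fun h => x (g^-1 * h)%g) = sqsum x.
Proof.
rewrite /sqsum -(@reindex_esum R G G setT setT (fun h => (g^-1 * h)%g)
  (fun h => (normc (x h) ^+ 2)%:E))//.
split=> // [h k _ _|h _]; first exact: mulgI.
by exists (g * h)%g => //; rewrite mulKg.
Qed.

Lemma lreg_subproof (g : G) (x : ell2) :
  (fun h => x (g^-1 * h)%g) \in sqsummable.
Proof. by rewrite /sqsummable unfold_in lreg_sqsum; case: x. Qed.

Definition lreg (g : G) : operator := fun x => Ell2 (lreg_subproof g x).

Lemma lreg_delta (g h : G) : lreg g (delta h) = delta (g * h)%g.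
Proof.
apply/val_inj/funext => k /=; congr (_%:R).
by rewrite -(inj_eq (mulgI g)) mulVKg.
Qed.

Definition diagonal : set operator := range mul_op.

(* The reduced crossed product of the diagonal algebra by G. *)
Definition crossed : set operator :=
  smallest cstar_subalgebra (diagonal `|` range lreg).

Lemma mul_op_bounded (f : linf) : bounded_op (mul_op f).
Proof.
split=> [a x y|].
  by apply/val_inj/funext => g /=; rewrite mulrDr; congr (_ + _); exact: mulrCA.
have [M fM] := linfP f; exists M => x; apply: ell2_norm_le => [|g].
  exact: le_trans (normc_ge0 (f 1%g)) (fM _).
by rewrite normcM ler_wpM2r ?normc_ge0.
Qed.

Lemma lreg_bounded (g : G) : bounded_op (lreg g).
Proof.
split=> [a x y|]; first exact/val_inj/funext.
by exists 1 => x; rewrite mul1r /ell2_norm /= lreg_sqsum.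
Qed.

Lemma crossed_cstar : cstar_subalgebra crossed.
Proof.
have genB : diagonal `|` range lreg `<=` bounded_op.
  by move=> _ [[f _ <-]|[g _ <-]]; [exact: mul_op_bounded|exact: lreg_bounded].
split=> [T|A [cA _]|T S TA SA A [cA gA]|a T TA A [cA gA]|T S TA SA A [cA gA]|
         T S TA SB TS A [cA gA]|T TB TA A [cA gA]].
- by apply; split=> //; exact: bounded_op_cstar.
- exact: cstar0.
- by apply: cstarD => //; [exact: TA|exact: SA].
- by apply: cstarZ => //; exact: TA.
- by apply: cstarM => //; [exact: TA|exact: SA].
- by apply: (cstar_adj cA) TS => //; exact: TA.
- apply: (cstar_closed cA) => // e /TA[S SA TS].
  by exists S => //; exact: SA.
Qed.

Lemma mul_op_crossed (f : linf) : crossed (mul_op f).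
Proof. by move=> A [_]; apply; left; exists f. Qed.

Lemma lreg_crossed (g : G) : crossed (lreg g).
Proof. by move=> A [_]; apply; right; exists g. Qed.

(* The value at u of the continuous extension of f to beta G. *)
Definition stone_ext (f : linf) (u : beta G) : C :=
  lim ((linf_fun f : G -> C^o) @ beta_filter u).

Lemma ultra_cvg (u : beta G) (h : G -> R) (M : R) :
  (forall g, `|h g| <= M) -> exists a : R, h @ beta_filter u --> a.
Proof.
move=> hM; have := @segment_compact R (- M) M; rewrite compact_ultra.
move=> /(_ (h @ beta_filter u) (fmap_ultra h (beta_ultra u)))[].
  rewrite /fmap /=; apply: filterS filterT => g _ /=.
  by rewrite in_itv /= -ler_norml.
by move=> a [_ ha]; exists a.
Qed.

Lemma norm_normc (z : C) : `|z| = (normc z)%:C%C.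
Proof. by case: z. Qed.

Lemma ge_normRe (z : C) : `|complex.Re z| <= normc z.
Proof.
case: z => a b /=; rewrite -sqrtr_sqr ler_wsqrtr// lerDl; exact: sqr_ge0.
Qed.

Lemma ge_normIm (z : C) : `|complex.Im z| <= normc z.
Proof.
case: z => a b /=; rewrite -sqrtr_sqr ler_wsqrtr// lerDr; exact: sqr_ge0.
Qed.

Lemma le_normcReIm (z : C) : normc z <= `|complex.Re z| + `|complex.Im z|.
Proof.
case: z => a b /=; rewrite -[leRHS]ger0_norm ?addr_ge0// -sqrtr_sqr.
rewrite ler_wsqrtr// sqrrD !real_normK ?num_real//.
by rewrite addrAC lerDl mulrn_wge0// mulr_ge0.
Qed.

Lemma cvg_normcP (F : set_system G) (f : G -> C) (l : C) : Filter F ->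
  (f : G -> C^o) @ F --> (l : C^o) <->
  forall e : R, 0 < e -> \forall g \near F, normc (l - f g) < e.
Proof.
move=> FF; split=> [/cvgrPdist_lt fl e e0|fl].
  have : 0 < e%:C%C by rewrite ltcR.
  by move=> /fl; apply: filterS => g; rewrite norm_normc ltcR.
apply/cvgrPdist_lt => e e0; have : e \is Num.real by rewrite gtr0_real.
move=> /complex_realP[r er]; rewrite er ltcR in e0.
by apply: filterS (fl _ e0) => g; rewrite er norm_normc ltcR.
Qed.

Lemma stone_ext_cvg (f : linf) (u : beta G) :
  (linf_fun f : G -> C^o) @ beta_filter u --> (stone_ext f u : C^o).
Proof.
have [M fM] := linfP f.
have [a fa] : exists a : R, complex.Re (f g) @[g --> beta_filter u] --> a.
  by apply: (@ultra_cvg _ _ M) => g; exact: le_trans (ge_normRe _) (fM g).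
have [b fb] : exists b : R, complex.Im (f g) @[g --> beta_filter u] --> b.
  by apply: (@ultra_cvg _ _ M) => g; exact: le_trans (ge_normIm _) (fM g).
apply: cvgP; apply/(@cvg_normcP _ _ (a +i* b)%C) => e e0.
have e2 : 0 < e / 2 by rewrite divr_gt0.
move/cvgrPdist_lt : fa => /(_ _ e2) fa; move/cvgrPdist_lt : fb => /(_ _ e2) fb.
near=> g; apply: le_lt_trans (le_normcReIm _) _.
rewrite (splitr e) !raddfB /=; apply: ltrD.
  by near: g; exact: fa.
by near: g; exact: fb.
Unshelve. all: by end_near. Qed.

Lemma stone_ext_principal (f : linf) (g : G) : stone_ext f (principal g) = f g.
Proof.
apply: (@cvg_lim C^o); first exact: norm_hausdorff.
by move=> A /nbhs_singleton fgA; apply/principal_filterP.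
Qed.

Lemma stone_ext_dist (f : linf) (u : beta G) (a : C) (e : R) :
  beta_filter u [set g | normc (a - f g) <= e] ->
  normc (a - stone_ext f u) <= e.
Proof.
move=> ue; apply/ler_addgt0Pr => d d0.
have /cvg_normcP/(_ _ d0) ud := stone_ext_cvg (f := f) (u := u).
have [g [/= gd ge]] := filter_ex (filterI ud ue).
rewrite (_ : a - _ = (a - f g) + - (stone_ext f u - f g)); last by ring.
apply: le_trans (le_normcD _ _) _; rewrite normcN.
by apply: lerD => //; exact: ltW.
Qed.

Lemma stone_ext_continuous (f : linf) :
  continuous (stone_ext f : beta G -> C^o).
Proof.
move=> u; apply/(cvgrPdist_lt (FF := nbhs_filter u)) => e e0.
have : e \is Num.real by rewrite gtr0_real.
move=> /complex_realP[r er]; rewrite er ltcR in e0.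
have r2 : 0 < r / 2 by rewrite divr_gt0.
have /cvg_normcP/(_ _ r2) ur := stone_ext_cvg (f := f) (u := u).
apply/nbhs_betaP; eexists; first exact: ur.
move=> v /= vr; rewrite er norm_normc ltcR.
apply: (@le_lt_trans _ _ (r / 2)).
  by apply: stone_ext_dist; apply: filterS vr => g; exact: ltW.
by rewrite ltr_pdivrMr// ltr_pMr// ltr1n.
Qed.

Lemma pi_linf_subproof (w : beta G) (f : linf) :
  exists M : R, forall g, normc (stone_ext f (beta_act g w)) <= M.
Proof.
have [M fM] := linfP f; exists M => g.
rewrite -normcN -sub0r; apply: stone_ext_dist.
by apply: filterS filterT => h _ /=; rewrite sub0r normcN.
Qed.

(* The homomorphism pi_w of the diagonal algebra, read on l^oo(G). *)
Definition pi_linf (w : beta G) (f : linf) : linf := Linf (pi_linf_subproof w f).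

Record is_pi_cross (w : beta G) (Phi : operator -> operator) : Prop := {
  pi_cross_star_hom : is_star_hom crossed Phi;
  pi_cross_sum : forall (n : nat) (f : 'I_n -> linf) (g : 'I_n -> G),
    Phi (\sum_(i < n) (mul_op (f i) \o lreg (g i))) =
    \sum_(i < n) (mul_op (pi_linf w (f i)) \o lreg (g i));
  pi_cross_series : forall (f : nat -> linf) (g : nat -> G) (T : operator),
    crossed T ->
    op_norm (T - \sum_(i < n) (mul_op (f i) \o lreg (g i)))
      @[n --> \oo] --> (0 : R) ->
    op_norm (Phi T - \sum_(i < n) (mul_op (pi_linf w (f i)) \o lreg (g i)))
      @[n --> \oo] --> (0 : R) }.

(* [is_pi_cross] constrains Phi on [crossed] only; the values elsewhere are
   irrelevant. The default 0 makes [calA w] trivial should no Phi exist. *)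
Definition pi_cross (w : beta G) : operator -> operator :=
  xget (fun=> 0) [set Phi | is_pi_cross w Phi].

Definition calA (w : beta G) : set operator := pi_cross w @` crossed.

End ell2.

Arguments crossed : clear implicits.
Arguments calA R {G} w.

(* Main.v *)
Require Import Defs.
From mathcomp Require Import all_boot all_order all_algebra.
From mathcomp Require Import finmap complex ring lra zify.
From mathcomp Require Import all_classical all_reals all_analysis.

Set Implicit Arguments.
Unset Strict Implicit.
Unset Printing Implicit Defensive.
Import Order.TTheory GRing.Theory Num.Theory numFieldNormedType.Exports.
Import Normc.
Local Open Scope classical_set_scope.
Local Open Scope ring_scope.

(** Wandering. Exhaust G by finite sets F_0, F_1, ... such that the product of
    two elements of F_n lies in F_{n+1}, and let l x be the first n with x in
    F_n.  Rareness, applied to the blocks {2n, 2n+1} and {2n-1, 2n} of levels,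
    gives a set B in w whose distinct elements have levels at distance at least
    2.  Translation by a fixed g changes large levels by at most 1, so B meets
    gB in a finite set when g <> 1 ([rare_sparse]).  The points of the corona
    that contain B are then a neighborhood of w with disjoint translates.

    The equality of algebras. Two maps carry the argument.
    - [wlim w T] has the matrix entries lim_{k -> w} T_{gk, hk}: it is a weak
      limit of conjugates of T by right translations.  It is a contraction
      defined on all bounded operators, it sends M_f U_g to M_{pi_w f} U_g, and
      as the crossed product is the norm closure of the finite sums of the
      M_f U_g ([crossedE]) it is a model of pi_w x lambda ([wlim_is_pi_cross]).
      Every other model agrees with it on the crossed product
      ([pi_cross_unique]), because each element there is the sum of a norm
      convergent series of terms M_f U_g ([crossed_series]).
    - Since B and its translates are almost disjoint, some c : G -> G has value
      g on a member of g.w, for all g at once ([orbit_reader]); in other words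
      the extension of c reads g off the point g.w of the orbit.  The map
      z |-> (c(z)^-1 z, c(z)) embeds G in G x G, hence l^2(G) in
      l^2(G) (x) l^2(G), and compressing 1 (x) S to l^2(G) gives
      [orbit_lift c S].  This is a contraction that preserves the crossed
      product and is a right inverse of [wlim w] on it ([wlim_orbit_lift]).
    So pi_w x lambda maps the crossed product into itself, by continuity, and
    onto itself, by the second map. *)

(** * Rare ultrafilters and sparse sets *)

(** The fibers of l are a partition into finite sets; indexing them by the range
    of l discards the empty ones. *)
Lemma rare_selector (N : Type) (u : beta N) (l : N -> nat) :
  rare u -> (forall n, finite_set (l @^-1` [set n])) ->
  exists2 B, beta_filter u B & {in B &, injective l}.
Proof.
move=> ru finl.
pose P (i : range l) := l @^-1` [set val i].
have [||B uB BP] := ru _ P.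
- split.
  + apply/seteqP; split=> // x _.
    have lx : l x \in range l by apply/mem_set; exists x.
    by exists (exist _ (l x) lx).
  + by move=> i j _ _ [x [ix jx]]; apply/val_inj; rewrite -ix -jx.
  + by move=> i _; have [x _ lx] := set_valP i; exists x.
- by move=> i; exact: finl.
exists B => // x y /set_mem Bx /set_mem By lxy.
have lx : l x \in range l by apply/mem_set; exists x.
by apply: (BP (exist _ (l x) lx)); split=> //=; rewrite /P /= -?lxy.
Qed.

Section level.
Variables (G : groupType) (e : G -> nat).

(** e enumerates G; the condition on e makes the stages exhaust G. *)
Fixpoint stage (n : nat) : set G :=
  if n is m.+1 then
    stage m `|` [set (p.1 * p.2)%g | p in stage m `*` stage m] `|` [set x | (e x <= m)%N]
  else [set 1%g].

Lemma stageS n m : (n <= m)%N -> stage n `<=` stage m.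
Proof.
move=> nm x nx; rewrite -(subnKC nm); elim: (m - n)%N => [|k IH].
  by rewrite addn0.
by rewrite addnS; left; left.
Qed.

Lemma stageM n x y : stage n x -> stage n y -> stage n.+1 (x * y)%g.
Proof. by move=> nx ny; left; right; exists (x, y). Qed.

Lemma stage_cover x : exists n, stage n x.
Proof. by exists (e x).+1; right; rewrite /mkset. Qed.

Hypothesis e_inj : injective e.

Lemma stage_finite n : finite_set (stage n).
Proof.
elim: n => [|n IH]; first exact: finite_set1.
rewrite /= !finite_setU; split; first split=> //.
  by apply/finite_image/finite_setX.
apply: (@sub_finite_set _ _ (e @^-1` `I_n.+1)) => //.
by apply: finite_preimage => [x y _ _ /e_inj|]; last exact: finite_II.
Qed.

End level.

Lemma countable_inj (T : choiceType) : countable [set: T] ->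
  exists e : T -> nat, injective e.
Proof.
move=> /countable_injP[e /in2TT e_inj].
by exists e.
Qed.

(** Distinct elements x, y of B have levels at distance at least 2.  If x and gx
    are both in B and the level of x exceeds the levels of g and its inverse by
    more than 1, then the levels of x and gx differ by at most 1, so gx = x. *)
Lemma rare_sparse (G : groupType) (u : beta G) :
  countable [set: G] -> rare u ->
  exists2 B, beta_filter u B &
    forall g : G, g != 1%g -> finite_set [set x | B x /\ B (g * x)%g].
Proof.
move=> /countable_inj[e e_inj] ru.
have ex_stage x : exists n, `[< stage e n x >].
  by have [n nx] := stage_cover e x; exists n; apply/asboolP.
pose l x := ex_minn (ex_stage x).
have lP x n : stage e n x <-> (l x <= n)%N.
  rewrite /l; case: ex_minnP => m /asboolP mx min; split.
    by move=> /asboolP/min.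
  by move=> mn; exact: stageS mx.
have l_finite n : finite_set [set x | (l x <= n)%N].
  apply: (@sub_finite_set _ _ (stage e n)); last exact: stage_finite.
  by move=> x /lP.
(* The blocks {2n, 2n+1} of levels, and then the blocks {2n-1, 2n}. *)
have [B1 uB1 B1l] : exists2 B, beta_filter u B & {in B &, injective (half \o l)}.
  apply: rare_selector => // n.
  apply: sub_finite_set (l_finite n.*2.+1) => x /= <-.
  by rewrite -{1}(odd_double_half (l x)); case: odd; rewrite // add0n.
have [B2 uB2 B2l] : exists2 B, beta_filter u B & {in B &, injective (uphalf \o l)}.
  apply: rare_selector => // n.
  apply: sub_finite_set (l_finite n.*2) => x /= <-.
  by rewrite -{1}(odd_double_half (l x)) uphalf_half doubleD; case: odd;
    rewrite // leq_add2r.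
exists (B1 `&` B2) => [|g g1]; first exact: filterI.
have far x y : (B1 `&` B2) x -> (B1 `&` B2) y -> (l x <= l y <= (l x).+1)%N -> x = y.
  move=> [x1 x2] [y1 y2] /andP[xy]; rewrite leq_eqVlt => /orP[/eqP ly|].
    have [lx|lx] := boolP (odd (l x)).
      apply: B2l; rewrite ?inE//= ly.
      by rewrite !uphalf_half /= lx add1n uphalf_half lx.
    apply: B1l; rewrite ?inE//= ly /= uphalf_half (negbTE lx) //.
  rewrite ltnS => yx; apply: B1l; rewrite ?inE//=.
  by congr half; apply/eqP; rewrite eqn_leq xy.
pose k := maxn (l g) (l g^-1%g).
have lM h x : (l h <= k -> l (h * x)%g <= (maxn k (l x)).+1)%N.
  move=> hk; apply/lP/stageM; apply/lP; first by rewrite leq_max hk.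
  exact: leq_maxr.
apply: (@sub_finite_set _ _ [set x | (l x <= k.+1)%N]); last exact: l_finite.
move=> x [Bx Bgx] /=; rewrite leqNgt; apply/negP => kx.
have gx : (l (g * x)%g <= (l x).+1)%N.
  by have := lM g x (leq_maxl _ _); rewrite (maxn_idPr (ltnW (ltnW kx))).
have xg : (l x <= (maxn k (l (g * x)%g)).+1)%N.
  by have := lM g^-1%g (g * x)%g (leq_maxr _ _); rewrite mulKg.
have {}xg : (l x <= (l (g * x)%g).+1)%N.
  by move: xg kx; lia.
have gxx : (g * x)%g = x.
  have [le|/ltnW le] := leqP (l x) (l (g * x)%g).
    by apply/esym/far => //; rewrite le.
  by apply: far => //; rewrite le.
by move/eqP: g1; apply; apply: (@mulIg _ x); rewrite gxx mul1g.
Qed.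

(** An ultrafilter that contains a finite set contains one of its points. *)
Lemma corona_cofinite (T : choiceType) (u : beta T) (A : set T) :
  corona T u -> finite_set A -> beta_filter u (~` A).
Proof.
move=> u_corona /finite_fsetP[D ->].
have uC x : beta_filter u (~` [set x]).
  have [ux|//] := in_ultra_setVsetC [set x] (beta_ultra u).
  case: u_corona; exists x => //; apply: beta_ext.
  apply/seteqP; split=> B.
    by move=> /principal_filterP Bx; apply: filterS ux => y ->.
  move=> uB; apply/principal_filterP.
  by have [y [By <-]] := filter_ex (filterI uB ux).
have : beta_filter u (\bigcap_(x in [set` D]) ~` [set x]).
  by apply: filter_bigI => x _; exact: uC.
by apply: filterS => x + Dx => /(_ x Dx); apply.
Qed.

Lemma rare_wandering (G : groupType) (w : corona G) :
  countable [set: G] -> rare (val w) -> wandering (@corona_act G) w.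
Proof.
move=> cG /(rare_sparse cG)[B wB Bfin].
exists [set v : corona G | beta_filter (val v) B].
  have := @initial_continuous _ _ (@set_val _ (corona G)) w
    [set v : beta G | beta_filter v B].
  by apply; apply/nbhs_betaP; exists B.
move=> g h gh; apply/seteqP; split=> // _ [[u uB <-] [v vB]].
move=> /(congr1 val)/(congr1 (@beta_filter G)) /= E.
have uG : corona G (val u) by exact: set_valP.
have gh1 : (h^-1 * g)%g != 1%g.
  by apply: contra gh => /eqP gh1; rewrite -(mulVKg h g) gh1 mulg1.
have uBC := corona_cofinite uG (Bfin _ gh1).
have : beta_filter (beta_act g (val u)) [set x | B (h^-1 * x)%g].
  rewrite -[beta_filter _]E /=; apply: filterS vB => x /=.
  by rewrite mulKg.
move=> /(filterI (filterI uB uBC))/filter_ex[x [[Bx nBx] /= Bgx]].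
by apply: nBx; split=> //; rewrite -mulgA.
Qed.

(** The sets gB are almost disjoint.  Removing from gB the finitely many hB with h
    enumerated before g makes them disjoint, and still leaves a member of g.w; c
    sends each point to the index of the set that contains it. *)
Lemma orbit_reader (G : groupType) (w : beta G) :
  corona G w -> countable [set: G] -> rare w ->
  exists c : G -> G, forall g, beta_filter (beta_act g w) (c @^-1` [set g]).
Proof.
move=> w_corona cG rw; have [B wB Bfin] := rare_sparse cG rw.
have [e e_inj] := countable_inj cG.
pose A g := [set x | B (g^-1 * x)%g /\ forall h, (e h < e g)%N -> ~ B (h^-1 * x)%g].
have A_inj x g h : A g x -> A h x -> g = h.
  move=> [gx ltg] [hx lth]; apply: e_inj; apply/eqP.
  by case: ltngtP => // [/lth|/ltg]; case.
exists (fun x => xget 1%g [set g | A g x]) => g.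
have finE : finite_set [set h | (e h < e g)%N].
  by apply: (@finite_preimage _ _ `I_(e g)) => [x y _ _ /e_inj|]; last exact: finite_II.
have /finite_fsetP[D DE] := finE.
have wD : beta_filter w (\bigcap_(h in [set` D]) [set x | B x -> ~ B (h^-1 * g * x)%g]).
  apply: filter_bigI => h hD.
  have hg : (h^-1 * g)%g != 1%g.
    apply/eqP => hg; have : [set` D] h by [].
    by rewrite -DE /= -(mulg1 h) -hg mulVKg ltnn.
  by apply: filterS (corona_cofinite w_corona (Bfin _ hg)) => x nB Bx Bhx; apply: nB.
apply: filterS (filterI wB wD) => x [Bx Dx].
have Agx : A g (g * x)%g.
  split; first by rewrite mulKg.
  move=> h hg; rewrite mulgA; apply: Dx => //.
  by rewrite -DE.
by apply: xget_subset1 => // h k; exact: A_inj.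
Qed.

(** * The Hilbert space of square summable families *)

Lemma esumZ_le (R : realType) (T : choiceType) (a : R) (f : T -> \bar R) :
  0 <= a -> (forall t, 0 <= f t)%E ->
  (\esum_(t in [set: T]) (a%:E * f t) <= a%:E * \esum_(t in [set: T]) f t)%E.
Proof.
move=> a0 f0; apply: ge_ereal_sup => _ [X finX <-].
rewrite -ge0_mule_fsumr//; apply: lee_wpmul2l; first by rewrite lee_fin.
by apply: ereal_sup_ubound; exists X.
Qed.

(** Optimizing over c recovers 2ab; this one estimate gives both the triangle
    inequality and the Cauchy-Schwarz inequality. *)
Lemma young_le (R : realFieldType) (n a b : R) : 0 <= a -> 0 <= b ->
  (forall c, 0 < c -> n <= c * a ^+ 2 + c^-1 * b ^+ 2) -> n <= 2 * a * b.
Proof.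
move=> a0 b0 H.
have [a00|an0] := eqVneq a 0.
  rewrite a00 mulr0 mul0r leNgt; apply/negP => n0.
  have c0 : 0 < 2 * b ^+ 2 / n + 1 by rewrite ltr_wpDl// divr_ge0 ?mulr_ge0 ?sqr_ge0// ltW.
  have := H _ c0; rewrite a00 expr0n mulr0 add0r ler_pdivlMl//.
  rewrite mulrDl mul1r divfK ?gt_eqF//; have := sqr_ge0 b; lra.
have [b00|bn0] := eqVneq b 0.
  rewrite b00 mulr0 leNgt; apply/negP => n0.
  have c0 : 0 < n / (a ^+ 2 + 1) by rewrite divr_gt0// ltr_wpDl// sqr_ge0.
  have := H _ c0; rewrite b00 expr0n mulr0 addr0.
  rewrite mulrAC ler_pdivlMr ?ltr_wpDl ?sqr_ge0//.
  rewrite ler_pM2l//; lra.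
have ap : 0 < a by rewrite lt_def an0.
have bp : 0 < b by rewrite lt_def bn0.
have := H (b / a) (divr_gt0 bp ap).
rewrite (_ : _ + _ = 2 * a * b)//.
by field; rewrite an0 bn0.
Qed.

Section Ell2.
Variables (R : realType) (G : groupType).
Local Notation C := R[i].
Local Notation ell2 := (ell2 R G).
Implicit Types x y z : ell2.

Lemma sqsumD_young (c : R) (x y : G -> C) : 0 < c ->
  (sqsum (x + y)%R <= (1 + c)%:E * sqsum x + (1 + c^-1)%:E * sqsum y)%E.
Proof.
move=> c0; have c1 : 0 < c^-1 by rewrite invr_gt0.
have ge0 (z : G -> C) g : (0 <= (normc (z g) ^+ 2)%:E)%E.
  by rewrite lee_fin sqr_ge0.
apply: (@le_trans _ _ (\esum_(g in [set: G]) ((1 + c)%:E * (normc (x g) ^+ 2)%:E +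
    (1 + c^-1)%:E * (normc (y g) ^+ 2)%:E))%E).
  apply: le_esum => g _; rewrite -!EFinM -EFinD lee_fin.
  apply: (@le_trans _ _ ((normc (x g) + normc (y g)) ^+ 2)).
    by rewrite ler_pXn2r ?nnegrE ?addr_ge0 ?normc_ge0//; exact: le_normcD.
  set a := normc (x g); set b := normc (y g).
  rewrite -subr_ge0 (_ : _ - _ = c * (a - c^-1 * b) ^+ 2).
    by rewrite mulr_ge0 ?sqr_ge0// ltW.
  by field; rewrite gt_eqF.
have c1' : 0 <= 1 + c by rewrite addr_ge0// ltW.
have c2 : 0 <= 1 + c^-1 by rewrite addr_ge0// ltW.
rewrite esumD => [|g _|g _]; first by apply: leeD; exact: esumZ_le.
  by rewrite mule_ge0// lee_fin.
by rewrite mule_ge0// lee_fin.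
Qed.

Lemma ell2_normD x y : ell2_norm (x + y) <= ell2_norm x + ell2_norm y.
Proof.
rewrite -(@ler_pXn2r _ 2%N) ?nnegrE ?addr_ge0 ?ell2_norm_ge0//.
have := @young_le _ (ell2_norm (x + y) ^+ 2 - ell2_norm x ^+ 2 - ell2_norm y ^+ 2)
  _ _ (ell2_norm_ge0 x) (ell2_norm_ge0 y).
have H : forall c : R, 0 < c ->
    ell2_norm (x + y) ^+ 2 - ell2_norm x ^+ 2 - ell2_norm y ^+ 2 <=
    c * ell2_norm x ^+ 2 + c^-1 * ell2_norm y ^+ 2.
  move=> c /(sqsumD_young x y); rewrite -[sqsum (_ + _)]/(sqsum (x + y : ell2)).
  by rewrite -!ell2_normE -!EFinM -EFinD lee_fin; lra.
by move=> /(_ H); rewrite sqrrD; lra.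
Qed.

Lemma ell2_normZ (a : C) x : ell2_norm (a *: x) = normc a * ell2_norm x.
Proof.
have le (b : C) y : ell2_norm (b *: y) <= normc b * ell2_norm y.
  by apply: ell2_norm_le => [|g]; rewrite ?normc_ge0// normcM.
apply/eqP; rewrite eq_le le /=.
have [->|a0] := eqVneq a 0; first by rewrite normc0 mul0r ell2_norm_ge0.
have na : 0 < normc a.
  by rewrite lt_def normc_ge0 andbT; apply: contra a0 => /eqP/eq0_normc ->.
rewrite -ler_pdivlMl// -normcV; apply: le_trans (le _ _).
by rewrite scalerA mulVf// scale1r.
Qed.

Lemma ell2_normN x : ell2_norm (- x) = ell2_norm x.
Proof. by rewrite -scaleN1r ell2_normZ normcN normc1 mul1r. Qed.

Lemma sqsum_ge_term (x : G -> C) g : ((normc (x g) ^+ 2)%:E <= sqsum x)%E.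
Proof.
apply: esum_ge; exists [set g]; first by split=> //; exact: finite_set1.
by rewrite fsbig_set1.
Qed.

Lemma normc_le_ell2_norm x g : normc (x g) <= ell2_norm x.
Proof.
rewrite -(@ler_pXn2r _ 2%N) ?nnegrE ?normc_ge0 ?ell2_norm_ge0//.
by rewrite -lee_fin ell2_normE sqsum_ge_term.
Qed.

Lemma ell2_norm0 : ell2_norm (0 : ell2) = 0.
Proof. by rewrite -(scale0r 0) ell2_normZ normc0 mul0r. Qed.

Lemma ell2_norm0_eq0 x : ell2_norm x <= 0 -> x = 0.
Proof.
move=> x0; apply/val_inj/funext => g; apply: eq0_normc.
by apply/eqP; rewrite eq_le normc_ge0 (le_trans (normc_le_ell2_norm x g)).
Qed.

Definition asum (u : G -> R) : \bar R := \esum_(g in [set: G]) `|u g|%:E.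

(** Not only the positive and negative parts, but any two nonnegative summable
    families with the right difference compute [rsum]; this makes it additive. *)
Lemma rsum_diff (p q : G -> R) :
  (forall g, 0 <= p g) -> (forall g, 0 <= q g) ->
  (asum p < +oo)%E -> (asum q < +oo)%E ->
  rsum (fun g => p g - q g) = fine (asum p) - fine (asum q).
Proof.
move=> p0 q0 sp sq; rewrite /rsum.
have := @esumB R G setT (EFin \o p) (EFin \o q) sp sq.
have E (r : G -> R) : (forall g, 0 <= r g) -> (\esum_(i in setT) (EFin \o r) i = asum r)%E.
  by move=> r0; apply: eq_esum => g _ /=; rewrite ger0_norm.
rewrite !E// => ->; [|by move=> g _; rewrite lee_fin..].
by rewrite fineB// ge0_fin_numE// esum_ge0// => g _; rewrite lee_fin.
Qed.

Lemma asumD_lt (u v : G -> R) : (asum u < +oo)%E -> (asum v < +oo)%E ->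
  (asum (fun g => u g + v g)%R < +oo)%E.
Proof. by move=> su sv; exact: (@summableD _ _ setT (EFin \o u) (EFin \o v)). Qed.

Definition rpos (u : G -> R) g := Num.max (u g) 0.
Definition rneg (u : G -> R) g := Num.max (- u g) 0.

Lemma asum_le (u v : G -> R) : (forall g, `|u g| <= `|v g|) -> (asum u <= asum v)%E.
Proof. by move=> uv; apply: le_esum => g _; rewrite lee_fin. Qed.

Lemma asum_fin (u : G -> R) : (asum u < +oo)%E -> asum u \is a fin_num.
Proof. by move=> su; rewrite ge0_fin_numE// esum_ge0// => g _; rewrite lee_fin. Qed.

Lemma asumD (u v : G -> R) : (forall g, 0 <= u g) -> (forall g, 0 <= v g) ->
  (asum (fun g => u g + v g)%R = asum u + asum v)%E.
Proof.
move=> u0 v0; rewrite /asum -esumD => [|g _|g _]; rewrite ?lee_fin//.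
by apply: eq_esum => g _; rewrite -EFinD !ger0_norm// addr_ge0.
Qed.

Lemma rposneg (u : G -> R) g : u g = rpos u g - rneg u g.
Proof.
rewrite /rpos /rneg; have /orP[ug|ug] := le_total 0 (u g).
  by rewrite max_l// max_r ?oppr_le0// subr0.
by rewrite max_r// max_l ?oppr_ge0// sub0r opprK.
Qed.

Lemma rposnegP (u : G -> R) : (asum u < +oo)%E ->
  [/\ forall g, 0 <= rpos u g, forall g, 0 <= rneg u g,
   (asum (rpos u) < +oo)%E & (asum (rneg u) < +oo)%E].
Proof.
move=> su; split=> [g|g||]; rewrite ?/rpos ?/rneg ?le_max ?lexx ?orbT//.
  apply: le_lt_trans su; apply: asum_le => g; rewrite /rpos /Num.max.
  by case: ifP => //; rewrite normr0.
apply: le_lt_trans su; apply: asum_le => g; rewrite /rneg /Num.max.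
by case: ifP => //; rewrite ?normr0 ?normrN.
Qed.

Lemma rsumD (u v : G -> R) : (asum u < +oo)%E -> (asum v < +oo)%E ->
  rsum (fun g => u g + v g) = rsum u + rsum v.
Proof.
move=> /rposnegP[pu nu spu snu] /rposnegP[pv nv spv snv].
have -> : (fun g => u g + v g) =
    (fun g => (rpos u g + rpos v g) - (rneg u g + rneg v g)).
  by apply/funext => g; rewrite {1}rposneg (rposneg v); ring.
have E w : rsum w = rsum (fun g => rpos w g - rneg w g).
  by congr rsum; apply/funext => g; exact: rposneg.
rewrite (E u) (E v) (rsum_diff pu nu spu snu) (rsum_diff pv nv spv snv).
rewrite (rsum_diff _ _ (asumD_lt spu spv) (asumD_lt snu snv)).
- by rewrite (asumD pu pv) (asumD nu nv) !fineD ?asum_fin//; ring.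
- by move=> g; exact: addr_ge0.
- by move=> g; exact: addr_ge0.
Qed.

Lemma rsum_abs_le (u : G -> R) : (asum u < +oo)%E -> `|rsum u| <= fine (asum u).
Proof.
move=> su; have [pu nu spu snu] := rposnegP su.
have -> : rsum u = fine (asum (rpos u)) - fine (asum (rneg u)).
  by rewrite -rsum_diff//; congr rsum; apply/funext => g; exact: rposneg.
have -> : asum u = (asum (rpos u) + asum (rneg u))%E.
  rewrite -asumD//; apply: eq_esum => g _ /=; congr EFin.
  rewrite /rpos /rneg; have /orP[ug|ug] := le_total 0 (u g).
    by rewrite max_l// max_r ?oppr_le0// addr0.
  by rewrite max_r// max_l ?oppr_ge0// add0r normrN.
rewrite fineD ?asum_fin//; apply: le_trans (ler_normB _ _) _.
by rewrite !ger0_norm// fine_ge0// esum_ge0// => g _; rewrite lee_fin.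
Qed.

Definition cabs (z : G -> C) := asum (fun g => normc (z g)).

Lemma cabs_ReIm (z : G -> C) : (cabs z < +oo)%E ->
  (asum (fun g => complex.Re (z g)) < +oo)%E /\
  (asum (fun g => complex.Im (z g)) < +oo)%E.
Proof.
move=> sz; split; apply: le_lt_trans sz; apply: asum_le => g.
  by rewrite (ger0_norm (normc_ge0 _)) ge_normRe.
by rewrite (ger0_norm (normc_ge0 _)) ge_normIm.
Qed.

Lemma csumD (z t : G -> C) : (cabs z < +oo)%E -> (cabs t < +oo)%E ->
  csum (fun g => z g + t g) = csum z + csum t.
Proof.
move=> /cabs_ReIm[rz iz] /cabs_ReIm[rt it].
apply/eqP; rewrite eq_complex /= -!rsumD//; apply/andP; split; apply/eqP;
  by congr rsum; apply/funext => g; case: (z g); case: (t g).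
Qed.

Lemma csum_conj (z : G -> C) : (cabs z < +oo)%E ->
  csum (fun g => (z g)^*%C) = (csum z)^*%C.
Proof.
move=> /cabs_ReIm[rz iz]; apply/eqP; rewrite eq_complex /=; apply/andP; split.
  by apply/eqP; congr rsum; apply/funext => g; case: (z g).
rewrite eq_sym -subr_eq0 -opprD oppr_eq0 -rsumD//.
  rewrite (_ : (fun g => _) = cst 0); last first.
    by apply/funext => g; case: (z g) => a b /=; rewrite subrr.
  have := @rsum_abs_le (cst 0) ; rewrite /asum esum1 => [/(_ (ltry _))|g _]; last by rewrite normr0.
  by rewrite /= normr_le0.
by apply: le_lt_trans iz; apply: asum_le => g; case: (z g) => a b /=; rewrite normrN.
Qed.

Lemma csum_abs_le (z : G -> C) : (cabs z < +oo)%E ->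
  normc (csum z) <= 2 * fine (cabs z).
Proof.
move=> sz; have [rz iz] := cabs_ReIm sz.
apply: le_trans (le_normcReIm _) _; rewrite mulr_natl mulr2n.
by apply: lerD; apply: le_trans (rsum_abs_le _) _ => //; rewrite fine_le ?asum_fin//;
  apply: asum_le => g; rewrite (ger0_norm (normc_ge0 _)) (ge_normRe, ge_normIm).
Qed.

Lemma asum_mul_le (x y : ell2) :
  (asum (fun g => normc (x g) * normc (y g))%R <= (ell2_norm x * ell2_norm y)%:E)%E.
Proof.
have H (c : R) : 0 < c -> (asum (fun g => normc (x g) * normc (y g))%R <=
    ((c * ell2_norm x ^+ 2 + c^-1 * ell2_norm y ^+ 2) / 2)%:E)%E.
  move=> c0; have c1 : 0 < c^-1 by rewrite invr_gt0.
  have c2 : 0 <= c / 2 by rewrite ltW// divr_gt0.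
  have c3 : 0 <= c^-1 / 2 by rewrite ltW// divr_gt0.
  rewrite mulrDl EFinD mulrAC (mulrAC c^-1) (EFinM (c / 2)) (EFinM (c^-1 / 2)).
  rewrite !ell2_normE.
  apply: (@le_trans _ _ (\esum_(g in [set: G]) ((c / 2)%:E * (normc (x g) ^+ 2)%:E +
      (c^-1 / 2)%:E * (normc (y g) ^+ 2)%:E))%E).
    apply: le_esum => g _; rewrite -!EFinM -EFinD lee_fin.
    set a := normc (x g); set b := normc (y g).
    rewrite ger0_norm; last by rewrite mulr_ge0 ?normc_ge0.
    rewrite -subr_ge0 (_ : _ - _ = c / 2 * (a - c^-1 * b) ^+ 2).
      by rewrite mulr_ge0 ?sqr_ge0.
    by field; rewrite gt_eqF.
  rewrite esumD => [|g _|g _].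
  - by apply: leeD; apply: esumZ_le => // g; rewrite lee_fin sqr_ge0.
  - by rewrite mule_ge0// lee_fin ?sqr_ge0.
  - by rewrite mule_ge0// lee_fin ?sqr_ge0.
have fin : asum (fun g => normc (x g) * normc (y g))%R \is a fin_num.
  by apply: asum_fin; apply: le_lt_trans (H 1 ltr01) _; rewrite ltry.
rewrite -(fineK fin) lee_fin.
have := @young_le _ (2 * fine (asum (fun g => normc (x g) * normc (y g)))) _ _
   (ell2_norm_ge0 x) (ell2_norm_ge0 y).
rewrite -mulrA ler_pM2l//; apply => c /H; rewrite -(fineK fin) lee_fin/=; lra.
Qed.

Lemma cabs_dot x y : (cabs (fun g => x g * (y g)^*%C)%R <= (ell2_norm x * ell2_norm y)%:E)%E.
Proof.
apply: le_trans (asum_mul_le x y); apply: asum_le => g.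
rewrite normcM (_ : normc (y g)^*%C = normc (y g))//.
by case: (y g) => a b /=; rewrite sqrrN.
Qed.

Lemma cabs_dot_lt x y : (cabs (fun g => x g * (y g)^*%C)%R < +oo)%E.
Proof. by apply: le_lt_trans (cabs_dot x y) _; rewrite ltry. Qed.

(** The factor 2 comes from bounding real and imaginary parts separately. *)
Lemma ell2_dot_le x y : normc (ell2_dot x y) <= 2 * (ell2_norm x * ell2_norm y).
Proof.
apply: le_trans (csum_abs_le (cabs_dot_lt x y)) _; rewrite ler_pM2l//.
by rewrite -lee_fin fineK ?cabs_dot// asum_fin// cabs_dot_lt.
Qed.

Lemma ell2_dotDl x x' y : ell2_dot (x + x') y = ell2_dot x y + ell2_dot x' y.
Proof.
rewrite /ell2_dot -csumD ?cabs_dot_lt//; congr csum; apply/funext => g /=.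
by rewrite mulrDl.
Qed.

Lemma ell2_dotDr x y y' : ell2_dot x (y + y') = ell2_dot x y + ell2_dot x y'.
Proof.
rewrite /ell2_dot -csumD ?cabs_dot_lt//; congr csum; apply/funext => g /=.
by rewrite rmorphD mulrDr.
Qed.

Lemma ell2_dot_self x : normc (ell2_dot x x) = ell2_norm x ^+ 2.
Proof.
have E g : x g * (x g)^*%C = ((normc (x g)) ^+ 2)%:C%C.
  rewrite -sqr_normc norm_normc -rmorphXn//.
have -> : ell2_dot x x = (ell2_norm x ^+ 2)%:C%C.
  apply/eqP; rewrite eq_complex /=; apply/andP; split; apply/eqP.
    rewrite /rsum (@eq_esum _ _ _ _ (fun g => (normc (x g) ^+ 2)%:E)); last first.
      move=> g _; rewrite funeposE /= E /= max_l// lee_fin sqr_ge0//.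
    rewrite [X in (_ - X)%E]esum1 ?sube0 -?[esum _ _]/(sqsum x) -?ell2_normE// => g _.
    by rewrite funenegE /= E /= max_r// lee_fin oppr_le0 sqr_ge0.
  rewrite /rsum !esum1 ?subee//= => g _.
    by rewrite funenegE /= E /= oppr0 max_r.
  by rewrite funeposE /= E /= max_r.
by rewrite /normc /= expr0n addr0 sqrtr_sqr ger0_norm// sqr_ge0.
Qed.

Lemma ell2_dotC x y : ell2_dot y x = (ell2_dot x y)^*%C.
Proof.
rewrite /ell2_dot -csum_conj ?cabs_dot_lt//; congr csum; apply/funext => g.
by rewrite rmorphM /= conjcK mulrC.
Qed.

Implicit Types T S : operator R G.
Definition opbound (M : R) T := forall x, ell2_norm (T x) <= M * ell2_norm x.

(** |Sy|^2 = (Sy, Sy) = (T S y, y) is at most 2 M |Sy| |y|. *)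
Lemma adjoint_opbound (M : R) T S : 0 <= M -> opbound M T -> is_adjoint T S ->
  opbound (2 * M) S.
Proof.
move=> M0 TM TS y; have [->|Sy] := eqVneq (ell2_norm (S y)) 0.
  by rewrite mulr_ge0 ?ell2_norm_ge0// mulr_ge0.
have Sy0 : 0 < ell2_norm (S y) by rewrite lt_def Sy ell2_norm_ge0.
rewrite -(ler_pM2r Sy0) -expr2 -ell2_dot_self -TS.
apply: le_trans (ell2_dot_le _ _) _.
by rewrite -!mulrA ler_pM2l// [leRHS]mulrCA [leLHS]mulrC ler_wpM2l ?ell2_norm_ge0.
Qed.

Lemma op_norm_le (M : R) T : 0 <= M -> opbound M T -> op_norm T <= M.
Proof.
move=> M0 TM; apply: ge_sup.
  by exists (ell2_norm (T 0)), 0 => //=; rewrite ell2_norm0.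
move=> _ [x /= x1 <-]; apply: le_trans (TM x) _.
by rewrite -[leRHS]mulr1 ler_wpM2l.
Qed.

Lemma bounded_opZ T (a : C) x : bounded_op T -> T (a *: x) = a *: T x.
Proof.
move=> [Tl _]; have T0 : T 0 = 0.
  have := Tl 1 0 0; rewrite !scale1r addr0 => /eqP.
  by rewrite -subr_eq subrr eq_sym => /eqP.
by rewrite -[a *: x]addr0 Tl T0 addr0.
Qed.

Lemma op_norm_bound T : bounded_op T -> opbound (op_norm T) T.
Proof.
move=> Tb x; have [M M0 TM] := bounded_op_bound Tb.
have [x0|x0] := eqVneq (ell2_norm x) 0.
  by rewrite x0 mulr0 -(mulr0 M) -x0.
have xp : 0 < ell2_norm x by rewrite lt_def x0 ell2_norm_ge0.
have nE : normc ((ell2_norm x)^-1%:C)%C = (ell2_norm x)^-1.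
  by rewrite /normc /= expr0n addr0 sqrtr_sqr ger0_norm// invr_ge0 ltW.
rewrite -ler_pdivrMr// mulrC -nE -ell2_normZ -bounded_opZ//.
apply: ub_le_sup; last first.
  by eexists; last reflexivity; rewrite /= ell2_normZ nE mulVf.
exists M => _ [y /= y1 <-]; apply: le_trans (TM y) _.
by rewrite -[leRHS]mulr1 ler_wpM2l.
Qed.

Lemma op_norm_ge0 T : bounded_op T -> 0 <= op_norm T.
Proof.
move=> Tb; apply: le_trans (ell2_norm_ge0 (T 0)) _; apply: ub_le_sup.
  have [M M0 TM] := bounded_op_bound Tb.
  exists M => _ [y /= y1 <-]; apply: le_trans (TM y) _.
  by rewrite -[leRHS]mulr1 ler_wpM2l.
by exists 0 => //=; rewrite ell2_norm0.
Qed.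

End Ell2.

(** * The crossed product as a norm closure *)

Section Crossed.
Variables (R : realType) (G : groupType).
Local Notation C := R[i].
Local Notation ell2 := (ell2 R G).
Local Notation linf := (linf R G).
Implicit Types (x y z : ell2) (T S : operator R G) (M N e : R).

Lemma opbound_le M N T : M <= N -> opbound M T -> opbound N T.
Proof. by move=> MN TM x; rewrite (le_trans (TM x))// ler_wpM2r ?ell2_norm_ge0. Qed.

Lemma opboundD M N T S : opbound M T -> opbound N S -> opbound (M + N) (T + S).
Proof. by move=> TM SN x; rewrite (le_trans (ell2_normD _ _))// mulrDl lerD. Qed.

Lemma opboundZ (a : C) M T : opbound M T -> opbound (normc a * M) (a *: T).
Proof.
by move=> TM x; rewrite [X in ell2_norm X]/(_ *: _) ell2_normZ -mulrA ler_wpM2l ?normc_ge0.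
Qed.

Lemma opboundN M T : opbound M T -> opbound M (- T).
Proof. by move=> TM x; rewrite ell2_normN. Qed.

Lemma opboundM M N T S : 0 <= M -> opbound M T -> opbound N S -> opbound (M * N) (T \o S).
Proof. by move=> M0 TM SN x; rewrite (le_trans (TM _))// -mulrA ler_wpM2l. Qed.

Lemma opbound_eq0 T : (forall e, 0 < e -> opbound e T) -> T = 0.
Proof.
move=> T0; apply/funext => x; apply: ell2_norm0_eq0.
apply/ler_addgt0Pr => e e0; rewrite add0r.
have x1 : 0 < ell2_norm x + 1 by rewrite ltr_wpDl// ell2_norm_ge0.
apply: le_trans (T0 (e / (ell2_norm x + 1)) _ x) _; first exact: divr_gt0.
by rewrite -mulrA ger_pMr// mulrC ler_pdivrMr// mul1r lerDl.
Qed.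

Lemma bounded_opD T S : bounded_op T -> bounded_op S -> bounded_op (T + S).
Proof. exact: (cstarD (bounded_op_cstar R G)). Qed.

Lemma bounded_opZl (a : C) T : bounded_op T -> bounded_op (a *: T).
Proof. exact: (cstarZ (bounded_op_cstar R G)). Qed.

Lemma bounded_opN T : bounded_op T -> bounded_op (- T).
Proof. by move=> /(bounded_opZl (-1)); rewrite scaleN1r. Qed.

Lemma bounded_opB T S : bounded_op T -> bounded_op S -> bounded_op (T - S).
Proof. by move=> bT /bounded_opN; exact: bounded_opD. Qed.

Lemma bounded_op_comp T S : bounded_op T -> bounded_op S -> bounded_op (T \o S).
Proof. exact: (cstarM (bounded_op_cstar R G)). Qed.

Lemma bounded_op_add T x y : bounded_op T -> T (x + y) = T x + T y.
Proof. by move=> [Tl _]; have := Tl 1 x y; rewrite !scale1r. Qed.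

Lemma bounded_op0 T : bounded_op T -> T 0 = 0.
Proof. by move=> bT; rewrite -[in LHS](scale0r (0 : ell2)) bounded_opZ// scale0r. Qed.

Lemma bounded_op_sub T x y : bounded_op T -> T (x - y) = T x - T y.
Proof. by move=> bT; rewrite bounded_op_add// -scaleN1r bounded_opZ// scaleN1r. Qed.

Lemma is_adjointD T T' S S' : is_adjoint T S -> is_adjoint T' S' ->
  is_adjoint (T + T') (S + S').
Proof.
move=> TS TS' x y; rewrite [X in ell2_dot X]/(T x + T' x) ell2_dotDl.
by rewrite [X in _ = ell2_dot _ X]/(S y + S' y) ell2_dotDr TS TS'.
Qed.

Lemma is_adjoint_opp T S : is_adjoint T S -> is_adjoint (- T) (- S).
Proof.
have D0 y : ell2_dot 0 y = 0.
  by apply: (@addrI _ (ell2_dot 0 y)); rewrite -ell2_dotDl !addr0.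
have N x y : ell2_dot (- x) y = - ell2_dot x y.
  by apply/eqP; rewrite -addr_eq0 -ell2_dotDl addNr D0.
have N' x y : ell2_dot x (- y) = - ell2_dot x y.
  by rewrite ell2_dotC N raddfN; congr (- _); rewrite [RHS]ell2_dotC.
by move=> TS x y; rewrite [X in ell2_dot X]/(- T x) [X in _ = ell2_dot _ X]/(- S y) N N' TS.
Qed.

Definition term (p : linf * G) : operator R G := mul_op p.1 \o lreg p.2.
(** A list of pairs (f, g) encodes the finite sum of the operators M_f U_g. *)
Definition tsum (s : seq (linf * G)) : operator R G := \sum_(p <- s) term p.

Lemma termE p x h : term p x h = p.1 h * x (p.2^-1 * h)%g.
Proof. by []. Qed.

Lemma term_bounded p : bounded_op (term p).
Proof. by apply: bounded_op_comp; [exact: mul_op_bounded|exact: lreg_bounded]. Qed.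

Lemma tsum_nil : tsum [::] = 0. Proof. by rewrite /tsum big_nil. Qed.

Lemma tsum_cons p s : tsum (p :: s) = term p + tsum s.
Proof. by rewrite /tsum big_cons. Qed.

Lemma tsum1 p : tsum [:: p] = term p.
Proof. by rewrite tsum_cons tsum_nil addr0. Qed.

Lemma tsum_cat s t : tsum (s ++ t) = tsum s + tsum t.
Proof. by rewrite /tsum big_cat. Qed.

Lemma tsum_ord n (f : 'I_n -> linf) (g : 'I_n -> G) :
  \sum_(i < n) (mul_op (f i) \o lreg (g i)) = tsum [seq (f i, g i) | i <- enum 'I_n].
Proof. by rewrite /tsum big_map big_enum. Qed.

Lemma bounded_opO : bounded_op (0 : operator R G).
Proof. exact: (cstar0 (bounded_op_cstar R G)). Qed.

Lemma tsum_bounded s : bounded_op (tsum s).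
Proof.
elim: s => [|p s IH]; first by rewrite tsum_nil; exact: bounded_opO.
by rewrite tsum_cons; apply: bounded_opD => //; exact: term_bounded.
Qed.

Lemma linf_scale_subproof (a : C) (f : linf) : exists M, forall g, normc (a * f g) <= M.
Proof.
have [M fM] := linfP f; exists (normc a * M) => g.
by rewrite normcM ler_wpM2l ?normc_ge0.
Qed.
Definition linf_scale a f : linf := Linf (linf_scale_subproof a f).

Lemma linf_comp_subproof (f : linf) (t : G -> G) : exists M, forall g, normc (f (t g)) <= M.
Proof. by have [M fM] := linfP f; exists M => g. Qed.
Definition linf_comp f t : linf := Linf (linf_comp_subproof f t).

Lemma linf_mul_subproof (f h : linf) : exists M, forall g, normc (f g * h g) <= M.
Proof.
have [M fM] := linfP f; have [N hN] := linfP h; exists (M * N) => g.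
by rewrite normcM ler_pM ?normc_ge0.
Qed.
Definition linf_mul f h : linf := Linf (linf_mul_subproof f h).

Lemma normc_conj (z : C) : normc (z^*)%C = normc z.
Proof. by case: z => a b /=; rewrite sqrrN. Qed.

Lemma linf_conj_subproof (f : linf) : exists M, forall g, normc (f g)^*%C <= M.
Proof. by have [M fM] := linfP f; exists M => g; rewrite normc_conj. Qed.
Definition linf_conj f : linf := Linf (linf_conj_subproof f).

Definition scale_term a (p : linf * G) := (linf_scale a p.1, p.2).

Lemma tsumZ a s : tsum (map (scale_term a) s) = a *: tsum s.
Proof.
elim: s => [|p s IH]; first by rewrite tsum_nil scaler0.
rewrite /= !tsum_cons IH scalerDr; congr (_ + _).
by apply/funext => x; apply/val_inj/funext => h /=; rewrite -mulrA.
Qed.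

(** M_f U_g M_h U_k = M_{f . (h o g^-1)} U_{gk}. *)
Definition mul_term (p q : linf * G) :=
  (linf_mul p.1 (linf_comp q.1 (fun h => p.2^-1 * h)%g), (p.2 * q.2)%g).

Lemma mul_termE p q : term (mul_term p q) = term p \o term q.
Proof.
apply/funext => x; apply/val_inj/funext => h /=.
by rewrite invgM mulrA mulgA.
Qed.

Lemma tsumM s t : tsum [seq mul_term p q | p <- s, q <- t] = tsum s \o tsum t.
Proof.
elim: s => [|p s IH]; first by rewrite tsum_nil.
rewrite /= tsum_cat IH tsum_cons.
suff -> : tsum [seq mul_term p q | q <- t] = term p \o tsum t by [].
elim: t {IH} => [|q t IH].
  by rewrite tsum_nil; apply/funext => x /=; rewrite bounded_op0//; exact: term_bounded.
rewrite /= !tsum_cons IH mul_termE; apply/funext => x.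
by rewrite /= bounded_op_add//; exact: term_bounded.
Qed.

(** The adjoint of M_f U_g is U_{g^-1} M_{conj f}, rewritten with the diagonal
    operator on the left. *)
Definition adj_term (p : linf * G) :=
  (linf_conj (linf_comp p.1 (fun h => p.2 * h)%g), p.2^-1%g).

Lemma rsum_shift (u : G -> R) (g : G) : rsum (fun h => u (g * h)%g) = rsum u.
Proof.
have sh (v : G -> \bar R) : (forall h, 0 <= v h)%E ->
    (\esum_(h in [set: G]) v (g * h)%g = \esum_(h in [set: G]) v h)%E.
  move=> v0; rewrite -(@reindex_esum R G G setT setT (fun h => (g * h)%g) v)//.
  split=> // [h k _ _|h _]; first exact: mulgI.
  by exists (g^-1 * h)%g => //; rewrite mulVKg.
rewrite /rsum; congr (fine (_ - _)).
  rewrite -(sh ((EFin \o u)^\+)%E); last by move=> h; exact: funepos_ge0.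
  by apply: eq_esum => h _; rewrite !funeposE.
rewrite -(sh ((EFin \o u)^\-)%E); last by move=> h; exact: funeneg_ge0.
by apply: eq_esum => h _; rewrite !funenegE.
Qed.

Lemma csum_shift (z : G -> C) (g : G) : csum (fun h => z (g * h)%g) = csum z.
Proof.
rewrite /csum (rsum_shift (fun h => complex.Re (z h))).
by rewrite (rsum_shift (fun h => complex.Im (z h))).
Qed.

Lemma adj_termP p : is_adjoint (term p) (term (adj_term p)).
Proof.
move=> x y; rewrite /ell2_dot.
rewrite -[RHS](csum_shift _ p.2^-1%g); congr csum.
apply/funext => g /=; rewrite rmorphM /= conjcK invgK !mulVKg.
by rewrite mulrAC mulrC mulrA.
Qed.

Lemma tsum_adj s : is_adjoint (tsum s) (tsum (map adj_term s)).
Proof.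
elim: s => [|p s IH].
  have id_adj : is_adjoint (id : operator R G) id by [].
  by have := is_adjointD id_adj (is_adjoint_opp id_adj); rewrite subrr !tsum_nil.
by rewrite /= !tsum_cons; apply: is_adjointD => //; exact: adj_termP.
Qed.

Definition approximable T :=
  bounded_op T /\ forall e, 0 < e -> exists s, opbound e (T - tsum s).

Lemma tsum_approximable s : approximable (tsum s).
Proof.
split=> [|e e0]; first exact: tsum_bounded.
by exists s; rewrite subrr => x; rewrite ell2_norm0 mulr_ge0 ?ell2_norm_ge0// ltW.
Qed.

(** The only closure that is not a routine estimate is the one under adjoints: it
    uses that the norm of an adjoint is controlled by [adjoint_opbound]. *)
Lemma approximable_cstar : cstar_subalgebra approximable.
Proof.
split.
- by move=> T [].
- by rewrite -tsum_nil; exact: tsum_approximable.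
- move=> T S [bT aT] [bS aS]; split=> [|e e0]; first exact: bounded_opD.
  have e2 : 0 < e / 2 by rewrite divr_gt0.
  have [s Ts] := aT _ e2; have [t St] := aS _ e2; exists (s ++ t).
  rewrite tsum_cat opprD addrACA (splitr e); exact: opboundD.
- move=> a T [bT aT]; split=> [|e e0]; first exact: bounded_opZl.
  have a1 : 0 < normc a + 1 by rewrite ltr_wpDl// normc_ge0.
  have [s Ts] := aT _ (divr_gt0 e0 a1); exists (map (scale_term a) s).
  rewrite tsumZ -scalerBr; apply: opbound_le (opboundZ a Ts).
  by rewrite mulrCA ger_pMr// ler_pdivrMr// mul1r lerDl.
- move=> T S [bT aT] [bS aS]; split=> [|e e0]; first exact: bounded_op_comp.
  have [M M0 TM] := bounded_op_bound bT.
  have e2 : 0 < e / 2 by rewrite divr_gt0.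
  have M1 : 0 < M + 1 by rewrite ltr_wpDl.
  have [t St] := aS (e / 2 / (M + 1)) (divr_gt0 e2 M1).
  have [N N0 tN] := bounded_op_bound (tsum_bounded t).
  have N1 : 0 < N + 1 by rewrite ltr_wpDl.
  have [s Ts] := aT (e / 2 / (N + 1)) (divr_gt0 e2 N1).
  exists [seq mul_term p q | p <- s, q <- t]; rewrite tsumM.
  have -> : (T \o S) - (tsum s \o tsum t) = (T \o (S - tsum t)) + ((T - tsum s) \o tsum t).
    apply/funext => x; rewrite -[LHS]/(T (S x) - tsum s (tsum t x)).
    rewrite -[RHS]/(T (S x - tsum t x) + (T (tsum t x) - tsum s (tsum t x))).
    by rewrite (bounded_op_sub _ _ bT) addrA subrK.
  rewrite (splitr e); apply: opboundD.
    apply: opbound_le (opboundM M0 TM St).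
    by rewrite mulrCA ger_pMr ?divr_gt0// ler_pdivrMr// mul1r lerDl.
  apply: opbound_le (opboundM _ Ts tN); last by rewrite ltW// !divr_gt0.
  by rewrite -mulrA ger_pMr ?divr_gt0// mulrC ler_pdivrMr// mul1r lerDl.
- move=> T S [bT aT] bS TS; split; first exact: bS.
  move=> e e0.
  have e2 : 0 < e / 2 by rewrite divr_gt0.
  have [s Ts] := aT _ e2; exists (map adj_term s).
  have := adjoint_opbound (ltW e2) Ts (is_adjointD TS (is_adjoint_opp (tsum_adj s))).
  by rewrite mulrC divfK.
- move=> T bT aT; split; first exact: bT.
  move=> e e0.
  have e2 : 0 < e / 2 by rewrite divr_gt0.
  have [S [bS aS] TS] := aT _ e2; have [s Ss] := aS _ e2; exists s.
  rewrite -(subrK S T) -addrA (splitr e); apply: opboundD => //.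
  by apply: opbound_le (op_norm_bound (bounded_opB bT bS)); exact: ltW.
Qed.

Lemma crossedE : crossed R G = approximable.
Proof.
apply/seteqP; split=> T.
  apply; split; first exact: approximable_cstar.
  move=> _ [[f _ <-]|[g _ <-]].
    suff -> : mul_op f = tsum [:: (f, 1%g)] by exact: tsum_approximable.
    rewrite tsum1; apply/funext => x; apply/val_inj/funext => h /=.
    by rewrite invg1 mul1g.
  have H : exists M, forall g : G, normc (1 : C) <= M by exists 1 => _; rewrite normc1.
  suff -> : lreg g = tsum [:: (Linf H, g)] by exact: tsum_approximable.
  rewrite tsum1; apply/funext => x; apply/val_inj/funext => h /=.
  by rewrite mul1r.
move=> [bT aT]; have [cB c0 cD cZ cM cA ccl] := crossed_cstar R G.
apply: ccl => // e e0; have e2 : 0 < e / 2 by rewrite divr_gt0.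
have [s Ts] := aT _ e2; exists (tsum s).
  elim: (s) => [|p s' IH]; first by rewrite tsum_nil.
  rewrite tsum_cons; apply: cD => //; apply: cM.
    exact: mul_op_crossed.
  exact: lreg_crossed.
apply: le_lt_trans (op_norm_le (ltW e2) Ts) _; lra.
Qed.

End Crossed.

(** * The weak limit of right translates *)

Section Limit.
Variables (R : realType) (G : groupType) (w : beta G).
Local Notation C := R[i].
Local Notation ell2 := (ell2 R G).
Local Notation linf := (linf R G).
Implicit Types (x y z : ell2) (T S : operator R G) (M N e : R).

Definition ulim (h : G -> C) : C := lim ((h : G -> C^o) @ beta_filter w).

Definition bounded_fam (h : G -> C) := exists M, forall k, normc (h k) <= M.

Lemma ulim_cvg h : bounded_fam h -> (h : G -> C^o) @ beta_filter w --> (ulim h : C^o).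
Proof. by move=> bh; exact: (@stone_ext_cvg R G (Linf bh) w). Qed.

Lemma ulimE h (l : C) : (h : G -> C^o) @ beta_filter w --> (l : C^o) -> ulim h = l.
Proof. by apply: (@cvg_lim C^o); exact: norm_hausdorff. Qed.

Lemma stone_ext_act (f : linf) g : stone_ext f (beta_act g w) = ulim (fun k => f (g * k)%g).
Proof. by []. Qed.

Lemma ulim_cst c : ulim (fun=> c) = c.
Proof. by apply: ulimE; exact: cvg_cst. Qed.

Lemma ulimD h k : bounded_fam h -> bounded_fam k -> ulim (fun g => h g + k g) = ulim h + ulim k.
Proof. by move=> /ulim_cvg bh /ulim_cvg bk; apply: ulimE; exact: (cvgD bh bk). Qed.

Lemma ulimM h k : bounded_fam h -> bounded_fam k -> ulim (fun g => h g * k g) = ulim h * ulim k.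
Proof. by move=> /ulim_cvg bh /ulim_cvg bk; apply: ulimE; exact: (cvgM bh bk). Qed.

Lemma bounded_fam_cst c : bounded_fam (fun=> c).
Proof. by exists (normc c). Qed.

Lemma bounded_famZ c h : bounded_fam h -> bounded_fam (fun k => c * h k).
Proof.
by move=> [M hM]; exists (normc c * M) => k; rewrite normcM ler_wpM2l ?normc_ge0.
Qed.

Lemma ulimZ (c : C) h : bounded_fam h -> ulim (fun g => c * h g) = c * ulim h.
Proof. by move=> bh; rewrite ulimM ?ulim_cst//; exact: bounded_fam_cst. Qed.

Lemma ulim_conj h : bounded_fam h -> ulim (fun g => (h g)^*%C) = (ulim h)^*%C.
Proof.
move=> /ulim_cvg /cvg_normcP hl; apply: ulimE; apply/cvg_normcP => e /hl.
by apply: filterS => g; rewrite -raddfB normc_conj.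
Qed.

Lemma normc_ulim h : bounded_fam h -> normc (h k) @[k --> beta_filter w] --> normc (ulim h).
Proof.
move=> /ulim_cvg /cvg_normcP hl; apply/cvgrPdist_lt => e /hl.
apply: filterS => k; apply: le_lt_trans.
have H (a b : C) : normc a - normc b <= normc (a - b).
  by rewrite lerBlDr; have := le_normcD (a - b) b; rewrite subrK.
rewrite ler_norml H andbT lerNl opprB.
by apply: le_trans (H _ _) _; rewrite -normcN opprB.
Qed.

(** Fatou's lemma along an ultrafilter: finite partial sums pass to the limit. *)
Lemma sqsum_ulim (y : G -> G -> C) (c : R) :
  (forall k, sqsum (y k) <= c%:E)%E -> (sqsum (fun g => ulim (y^~ g)) <= c%:E)%E.
Proof.
move=> yc; have bdd g : bounded_fam (y^~ g).
  exists (Num.sqrt c) => k; rewrite -(ger0_norm (normc_ge0 _)) -sqrtr_sqr ler_wsqrtr//.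
  by rewrite -lee_fin; apply: le_trans (yc k); exact: sqsum_ge_term.
apply: ge_ereal_sup => _ [X [finX _] <-].
rewrite fsbig_finite//= sumEFin lee_fin.
have cv (s : seq G) : (\sum_(g <- s) normc (y k g) ^+ 2) @[k --> beta_filter w]
    --> \sum_(g <- s) normc (ulim (y^~ g)) ^+ 2.
  elim: s => [|g s IH].
    rewrite big_nil; under eq_fun do rewrite big_nil; exact: cvg_cst.
  rewrite big_cons; under eq_fun do rewrite big_cons.
  apply: cvgD => //; rewrite expr2; under eq_fun do rewrite expr2.
  by apply: cvgM; exact: normc_ulim.
apply: (cvgr_to_le (cv _)); apply: filterS filterT => k _ /=.
rewrite -lee_fin -sumEFin; apply: le_trans (yc k).
by apply: ereal_sup_ubound; exists X => //; rewrite fsbig_finite.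
Qed.

Lemma rshift_sqsum (k : G) (x : G -> C) : sqsum (fun h => x (h * k^-1)%g) = sqsum x.
Proof.
rewrite /sqsum -(@reindex_esum R G G setT setT (fun h => (h * k^-1)%g)
  (fun h => (normc (x h) ^+ 2)%:E))//.
split=> // [h h' _ _|h _]; first exact: mulIg.
by exists (h * k)%g => //; rewrite mulgK.
Qed.

Lemma rshift_subproof (k : G) x : (fun h => x (h * k^-1)%g) \in @sqsummable R G.
Proof. by rewrite /sqsummable unfold_in rshift_sqsum; case: x. Qed.

Definition rshift k x : ell2 := Ell2 (rshift_subproof k x).

Lemma rshift_norm k x : ell2_norm (rshift k x) = ell2_norm x.
Proof. by rewrite /ell2_norm /= rshift_sqsum. Qed.

(** [rshift k] sends the basis vector at h to the one at hk, so this is the limit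
    along w of the conjugates of T by right translations. *)
Definition wlim_fun T x g := ulim (fun k => T (rshift k x) (g * k)%g).

Lemma rshift_mul_sqsum (k : G) (x : G -> C) : sqsum (fun h => x (h * k)%g) = sqsum x.
Proof. by rewrite -{1}(invgK k) rshift_sqsum. Qed.

Lemma wlim_fun_sqsum M T x : opbound M T ->
  (sqsum (wlim_fun T x) <= ((M * ell2_norm x) ^+ 2)%:E)%E.
Proof.
move=> TM; apply: sqsum_ulim => k; rewrite rshift_mul_sqsum -ell2_normE lee_fin.
rewrite ler_pXn2r ?nnegrE ?ell2_norm_ge0 ?(le_trans (ell2_norm_ge0 _) (TM x))//.
by rewrite -(rshift_norm k x).
Qed.

(** The default 0 is reached only if T is not bounded. *)
Definition wlim T : operator R G := fun x => insubd 0 (wlim_fun T x).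

Lemma wlimE T x g : bounded_op T -> wlim T x g = wlim_fun T x g.
Proof.
move=> [_ [M TM]]; congr (_ g); rewrite /wlim /insubd insubT//=.
rewrite /sqsummable unfold_in.
by apply: le_lt_trans (wlim_fun_sqsum x TM) _; rewrite ltry.
Qed.

Lemma wlim_opbound M T : 0 <= M -> bounded_op T -> opbound M T -> opbound M (wlim T).
Proof.
move=> M0 bT TM x; rewrite -(@ler_pXn2r _ 2%N) ?nnegrE ?mulr_ge0 ?ell2_norm_ge0//.
rewrite -lee_fin ell2_normE.
rewrite (_ : ell2_fun _ = wlim_fun T x); first exact: wlim_fun_sqsum.
by apply/funext => g; rewrite wlimE.
Qed.

Lemma bounded_fam_entry T x g : bounded_op T -> bounded_fam (fun k => T (rshift k x) (g * k)%g).
Proof.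
move=> [_ [M TM]]; exists (M * ell2_norm x) => k.
by rewrite (le_trans (normc_le_ell2_norm _ _))// (le_trans (TM _))// rshift_norm.
Qed.

Lemma wlim_bounded T : bounded_op T -> bounded_op (wlim T).
Proof.
move=> bT; split; last first.
  by have [M M0 TM] := bounded_op_bound bT; exists M; exact: wlim_opbound.
move=> a x y; apply/val_inj/funext => g.
rewrite -[RHS]/(a * wlim T x g + wlim T y g) [LHS]wlimE// !wlimE// /wlim_fun.
rewrite -ulimZ; last exact: bounded_fam_entry.
rewrite -ulimD; [|exact/bounded_famZ/bounded_fam_entry|exact: bounded_fam_entry].
congr ulim; apply/funext => k.
rewrite (_ : rshift k _ = a *: rshift k x + rshift k y) ?bT.1//.
exact/val_inj/funext.
Qed.

Lemma wlimD T S : bounded_op T -> bounded_op S -> wlim (T + S) = wlim T + wlim S.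
Proof.
move=> bT bS; apply/funext => x; apply/val_inj/funext => g.
rewrite -[RHS]/(wlim T x g + wlim S x g) [LHS]wlimE ?wlimE//; last exact: bounded_opD.
by rewrite /wlim_fun -ulimD//; exact: bounded_fam_entry.
Qed.

Lemma wlimZ (a : C) T : bounded_op T -> wlim (a *: T) = a *: wlim T.
Proof.
move=> bT; apply/funext => x; apply/val_inj/funext => g.
rewrite -[RHS]/(a * wlim T x g) [LHS]wlimE ?wlimE//; last exact: bounded_opZl.
by rewrite /wlim_fun -ulimZ//; exact: bounded_fam_entry.
Qed.

Lemma wlimB T S : bounded_op T -> bounded_op S -> wlim (T - S) = wlim T - wlim S.
Proof.
move=> bT bS; rewrite wlimD//; last exact: bounded_opN.
by rewrite -scaleN1r wlimZ// scaleN1r.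
Qed.

Definition pi_term (p : linf * G) := (pi_linf w p.1, p.2).

(** The matrix of a term has at most one nonzero entry per row, so entries of the
    composite are products and the limit is multiplicative for every bounded S. *)
Lemma wlim_term p S : bounded_op S -> wlim (term p \o S) = term (pi_term p) \o wlim S.
Proof.
move=> bS; apply/funext => x; apply/val_inj/funext => g.
rewrite [LHS]wlimE; last by apply: bounded_op_comp => //; exact: term_bounded.
rewrite [RHS]termE wlimE//= stone_ext_act /wlim_fun -ulimM.
- by congr ulim; apply/funext => k /=; rewrite mulgA.
- by have [M fM] := linfP p.1; exists M => k.
- exact: bounded_fam_entry.
Qed.

Lemma wlim_tsumM s S : bounded_op S ->
  wlim (tsum s \o S) = tsum (map pi_term s) \o wlim S.
Proof.
move=> bS; elim: s => [|p s IH].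
  rewrite !tsum_nil; apply/funext => x; apply/val_inj/funext => g /=.
  by rewrite wlimE; [exact: ulim_cst|exact: bounded_opO].
rewrite /= !tsum_cons.
rewrite (_ : (term p + tsum s) \o S = (term p \o S) + (tsum s \o S))//.
rewrite wlimD ?wlim_term ?IH//; apply: bounded_op_comp => //.
  exact: term_bounded.
exact: tsum_bounded.
Qed.

Lemma id_bounded : bounded_op (id : operator R G).
Proof. by split=> //; exists 1 => x; rewrite mul1r. Qed.

Lemma wlim_id : wlim id = id.
Proof.
apply/funext => x; apply/val_inj/funext => g /=; rewrite wlimE; last exact: id_bounded.
rewrite /wlim_fun /= -[RHS]ulim_cst; congr ulim; apply/funext => k.
by rewrite mulgK.
Qed.

Lemma wlim_tsum s : wlim (tsum s) = tsum (map pi_term s).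
Proof. by have := wlim_tsumM s id_bounded; rewrite wlim_id. Qed.

Lemma wlim_crossed T : crossed R G T -> crossed R G (wlim T).
Proof.
rewrite crossedE => -[bT aT]; split=> [|e e0]; first exact: wlim_bounded.
have [s Ts] := aT _ e0; exists (map pi_term s).
rewrite -wlim_tsum -wlimB//; last exact: tsum_bounded.
apply: wlim_opbound => //; first exact: ltW.
by apply: bounded_opB => //; exact: tsum_bounded.
Qed.

Lemma pi_linf_adj p : term (pi_term (adj_term p)) = term (adj_term (pi_term p)).
Proof.
apply/funext => x; apply/val_inj/funext => h; rewrite /= !stone_ext_act /=.
rewrite ulim_conj; last by have [M fM] := linfP p.1; exists M => k.
by congr (_^*%C * _); congr ulim; apply/funext => k; rewrite mulgA.
Qed.

Lemma tsum_pi_adj s :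
  is_adjoint (tsum (map pi_term s)) (tsum (map pi_term (map (@adj_term R G) s))).
Proof.
suff -> : tsum (map pi_term (map (@adj_term R G) s)) = tsum (map (@adj_term R G) (map pi_term s)).
  exact: tsum_adj.
by elim: s => [//|p s IH]; rewrite /= !tsum_cons IH pi_linf_adj.
Qed.

(** True for finite sums T by [wlim_tsumM], and both sides are continuous in T. *)
Lemma wlimM T S : crossed R G T -> bounded_op S -> wlim (T \o S) = wlim T \o wlim S.
Proof.
rewrite crossedE => -[bT aT] bS; apply/eqP; rewrite -subr_eq0; apply/eqP.
apply: opbound_eq0 => e e0.
have [M M0 SM] := bounded_op_bound bS.
have M1 : 0 < 2 * M + 1 by rewrite ltr_wpDl// mulr_ge0.
have d0 : 0 < e / (2 * M + 1) by rewrite divr_gt0.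
have [s Ts] := aT _ d0; have bs := tsum_bounded s.
have -> : wlim (T \o S) - (wlim T \o wlim S) =
    wlim ((T - tsum s) \o S) - (wlim (T - tsum s) \o wlim S).
  rewrite (_ : (T - tsum s) \o S = (T \o S) - (tsum s \o S))//.
  rewrite !wlimB//; try exact: bounded_op_comp.
  rewrite (wlim_tsumM s bS) wlim_tsum.
  rewrite (_ : (wlim T - _) \o wlim S =
    (wlim T \o wlim S) - (tsum (map pi_term s) \o wlim S))//.
  by rewrite opprB addrA subrK.
set d := e / _ in d0 Ts.
have bB := bounded_opB bT bs.
have A : opbound (d * M) (wlim ((T - tsum s) \o S)).
  apply: wlim_opbound; first by rewrite mulr_ge0// ltW.
    exact: bounded_op_comp.
  by apply: opboundM => //; exact: ltW.
have B : opbound (d * M) (wlim (T - tsum s) \o wlim S).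
  apply: opboundM; first exact: ltW.
    by apply: wlim_opbound => //; exact: ltW.
  exact: wlim_opbound.
apply: (opbound_le _ (opboundD A (opboundN B))).
have -> : d * M + d * M = e * (2 * M) / (2 * M + 1).
  by rewrite /d; field; rewrite gt_eqF.
by rewrite (ler_pdivrMr _ _ M1) (ler_pM2l e0) lerDl ler01.
Qed.

(** Approximate T by a finite sum; its adjoint approximates S, and on finite sums
    pi_w commutes with conjugation. *)
Lemma wlim_adj T S : crossed R G T -> bounded_op S -> is_adjoint T S ->
  is_adjoint (wlim T) (wlim S).
Proof.
rewrite crossedE => -[bT aT] bS TS x y; apply/eqP; rewrite -subr_eq0; apply/eqP.
apply: eq0_normc; apply/eqP; rewrite eq_le normc_ge0 andbT.
apply/ler_addgt0Pr => e e0; rewrite add0r.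
set K := ell2_norm x * ell2_norm y.
have K0 : 0 <= K by rewrite mulr_ge0 ?ell2_norm_ge0.
(* An error d for T and an error 2 d for S change inner products by at most
   2 d K and 4 d K. *)
have K1 : 0 < 6 * K + 1 by rewrite ltr_wpDl// mulr_ge0.
have d0 : 0 < e / (6 * K + 1) by rewrite divr_gt0.
have [s Ts] := aT _ d0; have bs := tsum_bounded s.
set d := e / _ in d0 Ts.
have St : opbound (2 * d) (S - tsum (map (@adj_term R G) s)).
  exact: adjoint_opbound (ltW d0) Ts (is_adjointD TS (is_adjoint_opp (tsum_adj s))).
have ba := tsum_bounded (map (@adj_term R G) s).
have eT : wlim T x = wlim (T - tsum s) x + tsum (map pi_term s) x.
  by rewrite wlimB// wlim_tsum [X in _ = X + _]/(_ - _) subrK.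
have eS : wlim S y = wlim (S - tsum (map (@adj_term R G) s)) y +
    tsum (map pi_term (map (@adj_term R G) s)) y.
  by rewrite wlimB// wlim_tsum [X in _ = X + _]/(_ - _) subrK.
rewrite eT eS ell2_dotDl ell2_dotDr tsum_pi_adj opprD addrACA subrr addr0.
apply: le_trans (le_normcD _ _) _; rewrite normcN.
have d20 : 0 <= 2 * d by rewrite mulr_ge0// ltW.
have A := wlim_opbound (ltW d0) (bounded_opB bT bs) Ts x.
have B := wlim_opbound d20 (bounded_opB bS ba) St y.
have A' : normc (ell2_dot (wlim (T - tsum s) x) y) <= 2 * (d * K).
  apply: le_trans (ell2_dot_le _ _) _; rewrite ler_pM2l// mulrA ler_wpM2r ?ell2_norm_ge0//.
have B' : normc (ell2_dot x (wlim (S - tsum (map (@adj_term R G) s)) y)) <= 2 * (2 * d * K).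
  apply: le_trans (ell2_dot_le _ _) _; rewrite ler_pM2l// mulrCA ler_wpM2l ?ell2_norm_ge0//.
apply: le_trans (lerD A' B') _.
have -> : 2 * (d * K) + 2 * (2 * d * K) = e * (6 * K) / (6 * K + 1).
  by rewrite /d; field; rewrite gt_eqF.
by rewrite (ler_pdivrMr _ _ K1) (ler_pM2l e0) lerDl ler01.
Qed.

Lemma tsum_mkseq (f : nat -> linf) (g : nat -> G) n :
  \sum_(i < n) (mul_op (f i) \o lreg (g i)) = tsum [seq (f i, g i) | i <- iota 0 n].
Proof.
rewrite -(big_mkord xpredT (fun i => mul_op (f i) \o lreg (g i))).
by rewrite /index_iota subn0 /tsum big_map.
Qed.

Lemma wlim_is_pi_cross : is_pi_cross w wlim.
Proof.
have bC T : crossed R G T -> bounded_op T by exact: (cstar_bounded (crossed_cstar R G)).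
split.
- split.
  + by move=> T /bC; exact: wlim_bounded.
  + by move=> T S /bC bT /bC bS; exact: wlimD.
  + by move=> a T /bC bT; exact: wlimZ.
  + by move=> T S cT /bC bS; exact: wlimM.
  + by move=> T S cT /bC bS; exact: wlim_adj.
- move=> n f g; rewrite tsum_ord wlim_tsum -map_comp.
  by rewrite /tsum big_map big_enum.
- move=> f g T /bC bT Tlim.
  have E n : wlim T - \sum_(i < n) (mul_op (pi_linf w (f i)) \o lreg (g i)) =
      wlim (T - \sum_(i < n) (mul_op (f i) \o lreg (g i))).
    rewrite !tsum_mkseq wlimB//; last exact: tsum_bounded.
    by rewrite wlim_tsum -map_comp (tsum_mkseq (fun i => pi_linf w (f i))).
  apply: (squeeze_cvgr _ (cvg_cst 0) Tlim).
  apply: filterS filterT => n _; rewrite E tsum_mkseq.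
  have bd : bounded_op (T - tsum [seq (f i, g i) | i <- iota 0 n]).
    by apply: bounded_opB => //; exact: tsum_bounded.
  rewrite op_norm_ge0 /=; last exact: wlim_bounded.
  apply: op_norm_le; first exact: op_norm_ge0.
  by apply: wlim_opbound => //; [exact: op_norm_ge0|exact: op_norm_bound].
Qed.

End Limit.

(** * Norm convergent series of terms *)

(** The limit of a strictly growing chain of lists is an infinite sequence. *)
Lemma chain_limit (A : Type) (a0 : A) (s m : nat -> seq A) :
  (forall k, s k.+1 = s k ++ m k) -> (forall k, (0 < size (m k))%N) ->
  (forall k, (k <= size (s k))%N) /\ exists u, forall n, take n (s n) = map u (iota 0 n).
Proof.
move=> sS m0.
have size_s k : (k <= size (s k))%N.
  by elim: k => // k IH; rewrite sS size_cat -addn1 leq_add.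
split=> //.
have s_prefix j k : (j <= k)%N -> exists m, s k = s j ++ m.
  move=> jk; rewrite -(subnKC jk); elim: (k - j)%N => [|i [t IH]].
    by exists [::]; rewrite addn0 cats0.
  by rewrite addnS sS IH; eexists; rewrite -catA.
exists (fun n => nth a0 (s n.+1) n) => n.
have sz : size (take n (s n)) = n by rewrite size_take_min (minn_idPl (size_s n)).
apply: (@eq_from_nth _ a0) => [|i]; rewrite sz ?size_map ?size_iota// => i_n.
rewrite nth_take// (nth_map 0%N) ?size_iota// nth_iota// add0n.
have [t ->] := s_prefix _ _ i_n; rewrite nth_cat.
by rewrite (size_s i.+1).
Qed.

Section Series.
Variables (R : realType) (G : groupType).
Local Notation C := R[i].
Local Notation ell2 := (ell2 R G).
Local Notation linf := (linf R G).
Implicit Types (x y z : ell2) (T S : operator R G) (M N e : R).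
Implicit Types (l m s : seq (linf * G)).

Lemma normc_real (t : R) : normc t%:C%C = `|t|.
Proof. by rewrite /normc /= expr0n addr0 sqrtr_sqr. Qed.

Lemma partial_sums_bound s : exists2 M, 0 <= M & forall n, opbound M (tsum (take n s)).
Proof.
have op0 : opbound 0 (0 : operator R G) by move=> x; rewrite ell2_norm0 mul0r.
elim: s => [|p s [M M0 sM]]; first by exists 0 => // n; rewrite tsum_nil.
have [N N0 pN] := bounded_op_bound (term_bounded p).
exists (N + M) => [|[|n]]; first exact: addr_ge0.
  by rewrite tsum_nil; apply: (opbound_le _ op0); rewrite addr_ge0.
by rewrite /= tsum_cons; exact: opboundD.
Qed.

Let zero_linf : linf := Linf (@bounded_fam_cst R G 0).
Let z0 : linf * G := (zero_linf, 1%g).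
Let term_z0 : term z0 = 0.
Proof. by apply/funext => x; apply/val_inj/funext => h /=; rewrite mul0r. Qed.

(** Appending to l a list with sum D = tsum s - tsum l moves the error from that of
    l to that of s, but the partial sums in between may be large.  Appending
    instead N copies of a list for D scaled by 1/N keeps them under control:
    after j copies the error is a convex combination of the two end errors, and
    the partial sums inside one copy are small. *)
Lemma slow_approach T l s (e e' : R) : 0 < e -> 0 < e' ->
  opbound e (T - tsum l) -> opbound e' (T - tsum s) ->
  exists m, opbound e' (T - tsum (l ++ m)) /\
    forall n, opbound (2 * e + e') (T - tsum (l ++ take n m)).
Proof.
move=> e0 e'0 Tl Ts.
pose r := s ++ map (scale_term (-1)) l.
have rE : tsum r = tsum s - tsum l by rewrite tsum_cat tsumZ scaleN1r.
have [M M0 rM] := partial_sums_bound r.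
pose N := (Num.truncn (M / e)).+1; pose c : R := N%:R^-1.
have cM : c * M <= e.
  by rewrite ler_pdivrMl ?ltr0n// -ler_pdivrMr// ltW// truncnS_gt.
have H j : (j <= N)%N -> exists m,
    tsum m = (c *+ j)%:C%C *: tsum r /\
    forall n, opbound (2 * e + e') (T - tsum (l ++ take n m)).
  elim: j => [_|j IH jN].
    exists [::]; rewrite mulr0n scale0r tsum_nil; split=> // n; rewrite cats0.
    by apply: (opbound_le _ Tl); lra.
  have [m [mE mP]] := IH (ltnW jN).
  exists (m ++ map (scale_term c%:C%C) r); split.
    by rewrite tsum_cat mE tsumZ -scalerDl mulrSr rmorphD.
  move=> n; rewrite take_cat; case: ifP => // _; rewrite -map_take catA.
  move: (n - size m)%N => i; rewrite !tsum_cat mE tsumZ rE.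
  set t := c *+ j.
  have t0 : 0 <= t by rewrite mulrn_wge0// invr_ge0.
  have t1 : t <= 1.
    by rewrite /t -mulr_natl ler_pdivrMr ?ltr0n// mul1r ler_nat ltnW.
  have -> : T - (tsum l + t%:C%C *: (tsum s - tsum l) + c%:C%C *: tsum (take i r)) =
      ((1 - t)%:C%C *: (T - tsum l) + t%:C%C *: (T - tsum s)) - c%:C%C *: tsum (take i r).
    rewrite opprD addrA; congr (_ - _).
    have -> : tsum s - tsum l = (T - tsum l) - (T - tsum s).
      by rewrite opprB [RHS]addrC addrA subrK.
    by rewrite rmorphB rmorph1 scalerBl scale1r scalerBr opprD opprB !addrA [LHS]addrAC.
  apply: (opbound_le _ (opboundD (opboundD (opboundZ _ Tl) (opboundZ _ Ts))
    (opboundN (opboundZ _ (rM i))))).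
  rewrite !normc_real !ger0_norm ?subr_ge0 ?invr_ge0//.
  have : (1 - t) * e <= e by rewrite ger_pMl// gerBl.
  have : t * e' <= e' by rewrite ger_pMl.
  lra.
have [m [mE mP]] := H N (leqnn N); exists m; split=> //.
rewrite tsum_cat mE rE -mulr_natl mulfV ?pnatr_eq0// scale1r.
by rewrite [tsum l + _]addrC subrK.
Qed.

(** Repeated use of [slow_approach].  The error e k bounds the k-th list, and the
    intermediate errors are at most 2 e k + e (k+1), whence the factor 3. *)
Lemma crossed_chain T : crossed R G T -> exists (e : R) (s m : nat -> seq (linf * G)),
  [/\ 0 < e, forall k, (0 < size (m k))%N, forall k, s k.+1 = s k ++ m k &
      forall k n, opbound (e / k.+1%:R) (T - tsum (s k ++ take n (m k)))].
Proof.
rewrite crossedE => -[bT aT]; have [M M0 TM] := bounded_op_bound bT.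
pose e k : R := (M + 1) / k.+1%:R.
have M1 : 0 < M + 1 by lra.
have e0 k : 0 < e k by rewrite divr_gt0.
have e_le k : e k.+1 <= e k.
  by rewrite ler_pM2l// lef_pV2 ?posrE// ler_nat.
have step (kl : nat * seq (linf * G)) : exists m,
    opbound (e kl.1) (T - tsum kl.2) ->
    [/\ (0 < size m)%N, opbound (e kl.1.+1) (T - tsum (kl.2 ++ m)) &
      forall n, opbound (3 * e kl.1) (T - tsum (kl.2 ++ take n m))].
  case: kl => k l /=; have [Tl|nTl] := pselect (opbound (e k) (T - tsum l)); last by exists [::].
  have [s Ts] := aT _ (e0 k.+1).
  have [m [mT mP]] := slow_approach (e0 k) (e0 k.+1) Tl Ts.
  (* The zero term makes the appended list nonempty. *)
  exists (z0 :: m) => _; split=> //.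
    by rewrite tsum_cat tsum_cons term_z0 add0r -tsum_cat.
  move=> [|n] /=; first by rewrite cats0; apply: (opbound_le _ Tl); have := e0 k; lra.
  rewrite tsum_cat tsum_cons term_z0 add0r -tsum_cat; apply: (opbound_le _ (mP n)).
  have := e_le k; lra.
have [F FP] := choice step.
have [s [s0 sS]] : exists s : nat -> seq (linf * G),
    s 0%N = [::] /\ forall k, s k.+1 = s k ++ F (k, s k).
  by exists (fix s k := if k is j.+1 then s j ++ F (j, s j) else [::]).
have sT0 : opbound (e 0%N) (T - tsum (s 0%N)).
  rewrite s0 tsum_nil subr0 => x; apply: le_trans (TM x) _.
  by rewrite /e divr1 ler_wpM2r ?ell2_norm_ge0//; lra.
have sT k : opbound (e k) (T - tsum (s k)).
  by elim: k => [//|k IH]; rewrite sS; have [] := FP (k, s k) IH.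
exists (3 * (M + 1)), s, (fun k => F (k, s k)); split=> //.
- by rewrite mulr_gt0.
- by move=> k; have [] := FP (k, s k) (sT k).
- by move=> k n; rewrite -mulrA; have [_ _] := FP (k, s k) (sT k); apply.
Qed.

Lemma chain_tail T e (s m : nat -> seq (linf * G)) k K n :
  0 < e -> (forall k, s k.+1 = s k ++ m k) ->
  (forall k n, opbound (e / k.+1%:R) (T - tsum (s k ++ take n (m k)))) ->
  (k <= K)%N -> (size (s k) <= n <= size (s K))%N ->
  opbound (e / k.+1%:R) (T - tsum (take n (s K))).
Proof.
move=> e0 sS sT kK; rewrite -(subnKC kK); elim: (K - k)%N => [|i IH].
  rewrite addn0 => /andP[le1 le2]; have -> : n = size (s k) by apply/eqP; rewrite eqn_leq le1 le2.
  by have := sT k 0%N; rewrite take0 cats0 take_size.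
rewrite addnS => /andP[le1 le2]; have [le3|lt3] := leqP n (size (s (k + i)%N)).
  by rewrite sS takel_cat//; apply: IH; rewrite le1.
rewrite sS take_cat ltnNge (ltnW lt3); apply: (opbound_le _ (sT _ _)).
by rewrite ler_pM2l// lef_pV2 ?posrE// ler_nat ltnS leq_addr.
Qed.

(** A convergent sequence of finite sums is not enough: the convergence asked of a
    model of pi_w x lambda is that of all the partial sums of a series. *)
Lemma crossed_series T : crossed R G T -> exists (f : nat -> linf) (g : nat -> G),
  op_norm (T - \sum_(i < n) (mul_op (f i) \o lreg (g i))) @[n --> \oo] --> (0 : R).
Proof.
move=> cT; have bT : bounded_op T by exact: (cstar_bounded (crossed_cstar R G)).
have [e [s [m [e0 m0 sS sT]]]] := crossed_chain cT.
have [size_s [u uE]] := chain_limit z0 sS m0.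
exists (fun n => (u n).1), (fun n => (u n).2).
apply/cvgrPdist_lt => eps eps0.
pose k := Num.truncn (e / eps).
have ek : e / k.+1%:R < eps.
  by rewrite ltr_pdivrMr// [ltRHS]mulrC -ltr_pdivrMr// truncnS_gt.
exists (size (s k)) => [//|n /= kn].
have -> : \sum_(i < n) (mul_op (u i).1 \o lreg (u i).2) = tsum (take n (s n)).
  rewrite (tsum_mkseq (fun i => (u i).1) (fun i => (u i).2)) uE; congr tsum.
  by apply: eq_map => i; rewrite -surjective_pairing.
have tl : opbound (e / k.+1%:R) (T - tsum (take n (s n))).
  apply: (chain_tail e0 sS sT); last by rewrite kn size_s.
  exact: leq_trans (size_s k) kn.
rewrite sub0r normrN ger0_norm; last first.
  exact: op_norm_ge0 (bounded_opB bT (tsum_bounded (take n (s n)))).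
apply: le_lt_trans ek; apply: op_norm_le tl.
by rewrite ltW// divr_gt0.
Qed.

Lemma op_norm_lim_unique (S_ : nat -> operator R G) T T' :
  (forall n, bounded_op (S_ n)) -> bounded_op T -> bounded_op T' ->
  op_norm (T - S_ n) @[n --> \oo] --> (0 : R) ->
  op_norm (T' - S_ n) @[n --> \oo] --> (0 : R) -> T = T'.
Proof.
move=> bS bT bT' /cvgr0_norm_lt lim /cvgr0_norm_lt lim'.
apply/eqP; rewrite -subr_eq0; apply/eqP; apply: opbound_eq0 => e e0.
have e2 : 0 < e / 2 by rewrite divr_gt0.
have [n [n1 n2]] := filter_ex (filterI (lim _ e2) (lim' _ e2)).
have {}n1 := ltW (le_lt_trans (ler_norm _) n1).
have {}n2 := ltW (le_lt_trans (ler_norm _) n2).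
have b := bounded_opB bT (bS n); have b' := bounded_opB bT' (bS n).
have -> : T - T' = (T - S_ n) - (T' - S_ n) by rewrite opprB addrA subrK.
rewrite (splitr e); apply: opboundD.
  exact: opbound_le n1 (op_norm_bound b).
exact: opboundN (opbound_le n2 (op_norm_bound b')).
Qed.

(** Both sides are limits of the images of the partial sums of one series. *)
Lemma pi_cross_unique (w : beta G) (Phi : operator R G -> operator R G) T :
  is_pi_cross w Phi -> crossed R G T -> Phi T = wlim w T.
Proof.
move=> PhiP cT; have [f [g fgT]] := crossed_series cT.
have bT : bounded_op T by exact: (cstar_bounded (crossed_cstar R G)).
apply: op_norm_lim_unique (pi_cross_series PhiP cT fgT)
  (pi_cross_series (wlim_is_pi_cross R w) cT fgT).
- by move=> n; rewrite (tsum_mkseq (fun i => pi_linf w (f i))); exact: tsum_bounded.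
- exact: (star_hom_bounded (pi_cross_star_hom PhiP)).
- exact: wlim_bounded.
Qed.

End Series.

(** * A right inverse of the weak limit *)

Section Lift.
Variables (R : realType) (G : groupType) (w : beta G) (c : G -> G).
Local Notation C := R[i].
Local Notation ell2 := (ell2 R G).
Local Notation linf := (linf R G).
Implicit Types (x y : ell2) (T S : operator R G) (M N e : R).

(** The pair (b, g) has the form (c(z)^-1 z, c(z)) exactly when c (g b) = g, and
    then z = g b. *)
Lemma chart_esum (a : G -> G -> \bar R) : (forall b g, 0 <= a b g)%E ->
  (\esum_(b in [set: G]) \esum_(g in [set: G])
     (if c (g * b)%g == g then a b g else 0) =
   \esum_(z in [set: G]) a ((c z)^-1 * z)%g (c z))%E.
Proof.
move=> a0; rewrite (@esum_esum R G G setT (fun=> setT)) => [|b g _ _]; last by case: ifP.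
pose phi z := ((c z)^-1 * z, c z)%g.
rewrite -(@esum_image R G (G * G)%type setT phi (fun p => a p.1 p.2)); last first.
  move=> z z' _ _ [E1 E2]; apply: (@mulgI _ (c z)^-1%g).
  by rewrite E1 E2.
rewrite [RHS]esum_mkcond; rewrite [LHS]esum_mkcond; apply: eq_esum => -[b g] _ /=.
rewrite mem_set//; case: eqP => [cg|cg].
  rewrite mem_set//; exists (g * b)%g => //.
  by rewrite /phi cg mulKg.
by rewrite memNset// => -[z _ [bE gE]]; apply: cg; rewrite -bE -gE mulVKg.
Qed.

Lemma indic_linf_subproof (P : G -> bool) : exists M, forall g, normc ((P g)%:R : C) <= M.
Proof. by exists 1 => g; case: (P g); rewrite ?normc1// normc0. Qed.
Definition indic_linf P : linf := Linf (indic_linf_subproof P).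

(** The embedding of l^2(G) in l^2(G x G) given by z |-> (c(z)^-1 z, c(z)) has the
    vectors [slice b x] as the components of the image of x. *)
Definition slice b x : ell2 :=
  mul_op (indic_linf (fun h => c (h * b)%g == h)) (rshift b^-1%g x).

Lemma sliceE b x h : slice b x h = (c (h * b)%g == h)%:R * x (h * b)%g.
Proof. by rewrite /= invgK. Qed.

Lemma slice_linear b (a : C) x y : slice b (a *: x + y) = a *: slice b x + slice b y.
Proof.
apply/val_inj/funext => h; rewrite [LHS]sliceE.
by rewrite -[RHS]/(a * slice b x h + slice b y h) !sliceE mulrDr mulrCA.
Qed.

(** The compression of 1 (x) S by that embedding: S acts on each slice. *)
Definition orbit_lift_fun S x z : C := S (slice ((c z)^-1 * z)%g x) (c z).

Lemma slice_sqsum x : (\esum_(b in [set: G]) sqsum (slice b x) = sqsum x)%E.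
Proof.
transitivity (\esum_(b in [set: G]) \esum_(g in [set: G])
    (if c (g * b)%g == g then (normc (x (g * b)%g) ^+ 2)%:E else 0))%E.
  apply: eq_esum => b _; apply: eq_esum => g _; rewrite sliceE.
  by case: eqP; rewrite ?mul1r// mul0r normc0 expr0n.
rewrite (@chart_esum (fun b g => (normc (x (g * b)%g) ^+ 2)%:E)) => [|b g].
  by apply: eq_esum => z _; rewrite mulVKg.
by rewrite lee_fin sqr_ge0.
Qed.

Lemma orbit_lift_fun_sqsum M S x : opbound M S ->
  (sqsum (orbit_lift_fun S x) <= ((M * ell2_norm x) ^+ 2)%:E)%E.
Proof.
move=> SM; rewrite /sqsum /orbit_lift_fun.
rewrite -(@chart_esum (fun b g => (normc (S (slice b x) g) ^+ 2)%:E)) => [|b g]; last first.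
  by rewrite lee_fin sqr_ge0.
apply: (@le_trans _ _ (\esum_(b in [set: G]) ((M ^+ 2)%:E * sqsum (slice b x)))%E).
  apply: le_esum => b _; apply: (@le_trans _ _ (sqsum (S (slice b x)))).
    by apply: le_esum => g _; case: ifP => //; rewrite lee_fin sqr_ge0.
  rewrite -!ell2_normE -EFinM -exprMn lee_fin ler_pXn2r ?nnegrE ?ell2_norm_ge0//.
  exact: le_trans (ell2_norm_ge0 _) (SM _).
apply: le_trans (esumZ_le _ _) _; rewrite ?sqr_ge0//.
  by move=> b; exact: sqsum_ge0.
by rewrite slice_sqsum exprMn (EFinM (M ^+ 2)) ell2_normE.
Qed.

Definition orbit_lift S : operator R G := fun x => insubd 0 (orbit_lift_fun S x).

Lemma orbit_liftE S x z : bounded_op S -> orbit_lift S x z = orbit_lift_fun S x z.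
Proof.
move=> [_ [M SM]]; congr (_ z); rewrite /orbit_lift /insubd insubT//=.
rewrite /sqsummable unfold_in.
by apply: le_lt_trans (orbit_lift_fun_sqsum x SM) _; rewrite ltry.
Qed.

Lemma orbit_lift_opbound M S : 0 <= M -> bounded_op S -> opbound M S -> opbound M (orbit_lift S).
Proof.
move=> M0 bS SM x; rewrite -(@ler_pXn2r _ 2%N) ?nnegrE ?mulr_ge0 ?ell2_norm_ge0//.
rewrite -lee_fin ell2_normE.
rewrite (_ : ell2_fun _ = orbit_lift_fun S x); first exact: orbit_lift_fun_sqsum.
by apply/funext => g; rewrite orbit_liftE.
Qed.

Lemma orbit_lift_bounded S : bounded_op S -> bounded_op (orbit_lift S).
Proof.
move=> bS; split; last first.
  by have [M M0 SM] := bounded_op_bound bS; exists M; exact: orbit_lift_opbound.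
move=> a x y; apply/val_inj/funext => z.
rewrite -[RHS]/(a * orbit_lift S x z + orbit_lift S y z) [LHS]orbit_liftE// !orbit_liftE// /orbit_lift_fun.
by rewrite slice_linear bS.1.
Qed.

Lemma orbit_liftD T S : bounded_op T -> bounded_op S -> orbit_lift (T + S) = orbit_lift T + orbit_lift S.
Proof.
move=> bT bS; apply/funext => x; apply/val_inj/funext => z.
by rewrite -[RHS]/(orbit_lift T x z + orbit_lift S x z) [LHS]orbit_liftE ?orbit_liftE//; exact: bounded_opD.
Qed.

Lemma orbit_liftN T : bounded_op T -> orbit_lift (- T) = - orbit_lift T.
Proof.
move=> bT; apply/funext => x; apply/val_inj/funext => z.
by rewrite -[RHS]/(- orbit_lift T x z) [LHS]orbit_liftE ?orbit_liftE//; exact: bounded_opN.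
Qed.

Lemma orbit_lift0 : orbit_lift 0 = 0.
Proof.
apply/funext => x; apply/val_inj/funext => z.
by rewrite [LHS]orbit_liftE//; exact: bounded_opO.
Qed.

(** The lift of M_f U_g is M_F U_g with F z = f (c z) when c (g^-1 z) = g^-1 c z,
    and F z = 0 otherwise. *)
Definition orbit_lift_term (p : linf * G) :=
  (linf_mul (linf_comp p.1 c) (indic_linf (fun z => c (p.2^-1 * z)%g == (p.2^-1 * c z)%g)),
   p.2).

Lemma orbit_lift_termE p : orbit_lift (term p) = term (orbit_lift_term p).
Proof.
apply/funext => x; apply/val_inj/funext => z.
rewrite [LHS]orbit_liftE; last exact: term_bounded.
rewrite /orbit_lift_fun [LHS]termE sliceE [RHS]termE /= mulrA.
by rewrite -mulgA mulVKg.
Qed.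

Lemma orbit_lift_tsum s : orbit_lift (tsum s) = tsum (map orbit_lift_term s).
Proof.
elim: s => [|p s IH]; first by rewrite tsum_nil orbit_lift0.
rewrite /= !tsum_cons orbit_liftD ?orbit_lift_termE ?IH//; first exact: term_bounded.
exact: tsum_bounded.
Qed.

Lemma orbit_lift_sub_tsum T s : bounded_op T ->
  orbit_lift (T - tsum s) = orbit_lift T - tsum (map orbit_lift_term s).
Proof.
move=> bT; rewrite -orbit_lift_tsum -orbit_liftN; last exact: tsum_bounded.
by rewrite -orbit_liftD//; apply/bounded_opN/tsum_bounded.
Qed.

Lemma orbit_lift_crossed T : crossed R G T -> crossed R G (orbit_lift T).
Proof.
rewrite crossedE => -[bT aT]; split=> [|e e0]; first exact: orbit_lift_bounded.
have [s Ts] := aT _ e0; exists (map orbit_lift_term s); rewrite -orbit_lift_sub_tsum//.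
apply: orbit_lift_opbound => //; first exact: ltW.
by apply: bounded_opB => //; exact: tsum_bounded.
Qed.

Hypothesis cP : forall g, beta_filter (beta_act g w) (c @^-1` [set g]).

(** On a member of h.w the function c is h, and on a member of g^-1 h.w it is
    g^-1 h; so near h.w the function F is constant with value f h. *)
Lemma pi_orbit_lift_term p : term (pi_term w (orbit_lift_term p)) = term p.
Proof.
apply/funext => x; apply/val_inj/funext => h /=.
congr (_ * _); rewrite stone_ext_act; apply: ulimE.
apply: cvg_near_cst.
have c1 : beta_filter w [set k | c (h * k)%g = h] by exact: cP.
have c2 : beta_filter w [set k | c (p.2^-1 * h * k)%g = (p.2^-1 * h)%g] by exact: cP.
apply: filterS (filterI c1 c2) => k [/= ck1 ck2].
by rewrite mulgA ck1 ck2 eqxx mulr1.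
Qed.

Lemma wlim_orbit_lift T : crossed R G T -> wlim w (orbit_lift T) = T.
Proof.
rewrite crossedE => -[bT aT]; apply/eqP; rewrite -subr_eq0; apply/eqP.
apply: opbound_eq0 => e e0.
have e2 : 0 < e / 2 by rewrite divr_gt0.
have [s Ts] := aT _ e2.
have bs := tsum_bounded s; have bTs := bounded_opB bT bs.
have E : wlim w (orbit_lift (tsum s)) = tsum s.
  rewrite orbit_lift_tsum wlim_tsum; elim: (s) => [//|p s' IH].
  by rewrite /= !tsum_cons IH pi_orbit_lift_term.
have -> : wlim w (orbit_lift T) - T = wlim w (orbit_lift (T - tsum s)) - (T - tsum s).
  rewrite orbit_lift_sub_tsum// wlimB; [|exact: orbit_lift_bounded|exact: tsum_bounded].
  by rewrite -orbit_lift_tsum E opprB addrA subrK.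
rewrite (splitr e); apply: opboundD; last exact: opboundN.
apply: wlim_opbound; rewrite ?(ltW e2)//; first exact: orbit_lift_bounded.
by apply: orbit_lift_opbound => //; exact: ltW.
Qed.

End Lift.

Theorem theorem25 (R : realType) (G : groupType) (w : corona G) :
  countable [set: G] ->
  rare (val w) ->
  wandering (@corona_act G) w /\ calA R (val w) = crossed R G.
Proof.
move=> cG rw; split; first exact: rare_wandering.
have [c cP] := orbit_reader (set_valP w) cG rw.
have piP : is_pi_cross (val w) (pi_cross (R := R) (val w)).
  apply: (@xgetPex _ _ [set Phi | is_pi_cross (val w) Phi]).
  by exists (wlim (val w)); exact: wlim_is_pi_cross.
rewrite /calA; apply/seteqP; split=> [_ [T cT <-]|T cT].
  by rewrite (pi_cross_unique piP cT); exact: wlim_crossed.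
exists (orbit_lift c T); first exact: orbit_lift_crossed.
rewrite (pi_cross_unique piP (orbit_lift_crossed c cT)).
exact: wlim_orbit_lift.
Qed.
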